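(* Let $X_1,X_2\subset\mathbb{R}^d$ be closed and convex and let $c\in C^2(X)$, $X=X_1\times X_2$, be nondegenerate. If $\mu_1\in\mathcal{P}(X_1)$ and $\mu_2\in\mathcal{P}(X_2)$ are compactly supported, then any optimal transport (any minimizer of $\pi\mapsto\int c\,d\pi$ over $\Pi(\mu_1,\mu_2)$) satisfies ${\sf quant}_2(C,1/d)$ for some $C>0$.
   Context: $\mathcal{P}(Y)$ denotes the Borel probability measures on $Y$ and $\Pi(\mu_1,\mu_2)$ the set of couplings. $c\in C^2(X)$ means that $c$ is defined and twice continuously differentiable on a neighborhood of $X$. $c$ is nondegenerate if the $d\times d$ matrix $D^2_{xy}c(x,y)=[\partial^2_{x_iy_j}c(x,y)]_{1\le i,j\le d}$ is invertible for all $(x,y)\in X$. A measure $\pi$ with finite second moment on $Y=\mathbb{R}^d\times\mathbb{R}^d$ (Euclidean metric) satisfies ${\sf quant}_2(C,\alpha)$ if for every $n\ge1$ there is a probability measure $\pi^n$ on $Y$ supported on at most $n$ points with $W_2(\pi^n,\pi)\le Cn^{-\alpha}$, where $W_2$ is the 2-Wasserstein distance. *)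

(* Defs.v *)
From mathcomp Require Import all_boot all_order all_algebra.
From mathcomp Require Import all_classical all_reals all_analysis.

Set Implicit Arguments.
Unset Strict Implicit.
Unset Printing Implicit Defensive.
Import Order.TTheory GRing.Theory Num.Theory.
Import numFieldNormedType.Exports.

Local Open Scope classical_set_scope.
Local Open Scope ring_scope.

(* [borelRV R d] is R^d with its Borel sigma-algebra.  It is convertible to
   ['rV[R]_d], which carries the (topological) normed structure.  As R^d is
   second countable, the product sigma-algebra that the library puts on
   [borelRV R d * borelRV R d] is the Borel sigma-algebra of R^d x R^d. *)
Notation borelRV R d := (g_sigma_algebraType (@open 'rV[R]_d)).

(* The library norms on ['rV[R]_d] and on products are sup norms; the
   Euclidean ones have to be written out. *)
Definition eucl_norm (R : realType) (d : nat) (p : 'rV[R]_d * 'rV[R]_d) : R :=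
  Num.sqrt (\sum_(i < d) p.1 0 i ^+ 2 + \sum_(i < d) p.2 0 i ^+ 2).

Definition eucl_dist (R : realType) (d : nat)
    (p q : 'rV[R]_d * 'rV[R]_d) : R :=
  eucl_norm (p - q).

Definition msupport (R : realType) (T : topologicalType)
    (mu : set T -> \bar R) : set T :=
  [set x | forall A : set T, open A -> A x -> (0 < mu A)%E].

Definition coupling (R : realType) (d1 d2 : measure_display)
    (T1 : measurableType d1) (T2 : measurableType d2)
    (mu1 : probability T1 R) (mu2 : probability T2 R)
    (pi : probability (T1 * T2)%type R) : Prop :=
  (forall A : set T1, measurable A -> pushforward pi fst A = mu1 A) /\
  (forall B : set T2, measurable B -> pushforward pi snd B = mu2 B).

Definition W2 (R : realType) (d : nat)
    (mu nu : probability (borelRV R d * borelRV R d)%type R) : \bar R :=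
  (ereal_inf [set \int[g]_z (eucl_dist z.1 z.2 ^+ 2)%:E
             | g in coupling mu nu] `^ 2^-1)%E.

Definition finite_second_moment (R : realType) (d : nat)
    (pi : probability (borelRV R d * borelRV R d)%type R) : Prop :=
  (\int[pi]_z (eucl_norm z ^+ 2)%:E < +oo)%E.

Definition quant2 (R : realType) (d : nat) (C alpha : R)
    (pi : probability (borelRV R d * borelRV R d)%type R) : Prop :=
  finite_second_moment pi /\
  forall n : nat, (1 <= n)%N ->
    exists pin : probability (borelRV R d * borelRV R d)%type R,
      (exists2 S : set (borelRV R d * borelRV R d), (S #<= `I_n)%card & pin S = 1%E) /\
      (W2 pin pi <= (C * n%:R `^ (- alpha))%:E)%E.

(* In finite dimension, continuity of the derivative [x |-> 'd f x] amounts to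
   continuity of [x |-> 'd f x v] for every [v]. *)
Definition C1_on (R : realType) (V : normedModType R) (U : set V)
    (f : V -> R) : Prop :=
  forall x : V, U x ->
    differentiable f x /\ forall v : V, {for x, continuous ('D_v f)}.

Definition C2_on (R : realType) (V : normedModType R) (U : set V)
    (f : V -> R) : Prop :=
  C1_on U f /\ forall v : V, C1_on U ('D_v f).

(* [c] is only meaningful on a neighborhood of [X]; being a total function, it
   has arbitrary values elsewhere. *)
Definition C2_near (R : realType) (V : normedModType R) (X : set V)
    (c : V -> R) : Prop :=
  exists2 U : set V, open U /\ X `<=` U & C2_on U c.

Definition D2xy (R : realType) (d : nat) (c : 'rV[R]_d * 'rV[R]_d -> R)
    (p : 'rV[R]_d * 'rV[R]_d) : 'M[R]_d :=
  \matrix_(i < d, j < d)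
    'D_((delta_mx 0 i : 'rV[R]_d, 0 : 'rV[R]_d))
      ('D_((0 : 'rV[R]_d, delta_mx 0 j : 'rV[R]_d)) c) p.

Definition nondegenerate_cost (R : realType) (d : nat)
    (X : set ('rV[R]_d * 'rV[R]_d)) (c : 'rV[R]_d * 'rV[R]_d -> R) : Prop :=
  forall p : 'rV[R]_d * 'rV[R]_d, X p -> D2xy c p \in unitmx.

(* The marginals being carried by [X1] and [X2], every coupling is carried by
   [X1 `*` X2], the set on which [c] is known to be defined. *)
Definition transport_cost (R : realType) (d : nat) (X1 X2 : set 'rV[R]_d)
    (c : 'rV[R]_d * 'rV[R]_d -> R)
    (pi : probability (borelRV R d * borelRV R d)%type R) : \bar R :=
  (\int[pi]_(z in X1 `*` X2) (c z)%:E)%E.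

Definition optimal_transport (R : realType) (d : nat) (X1 X2 : set 'rV[R]_d)
    (c : 'rV[R]_d * 'rV[R]_d -> R) (mu1 mu2 : probability (borelRV R d) R)
    (pi : probability (borelRV R d * borelRV R d)%type R) : Prop :=
  coupling mu1 mu2 pi /\
  forall pi' : probability (borelRV R d * borelRV R d)%type R,
    coupling mu1 mu2 pi' ->
    (transport_cost X1 X2 c pi <= transport_cost X1 X2 c pi')%E.

(* Main.v *)
(* Write G for the support of an optimal plan; it is compact.  Exchanging a bit
   of mass between neighborhoods of two points (x, y), (x', y') of G yields a
   competitor, so G is monotone:
     c(x, y) + c(x', y') <= c(x, y') + c(x', y).
   Near a point p0 of G, with M = D^2_xy c(p0), the second order mean value
   theorem turns this into (x - x') . M (y - y') <= e |x - x'| |y - y'| with e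
   as small as we like; hence (x, y) |-> x - M y, which takes its values in R^d,
   has a Lipschitz inverse on G near p0.  So G can be covered by O(k^d) balls of
   radius O(1/k), and pushing the plan to the centers of such balls gives the
   rate n^(-1/d). *)
Require Import Defs.
From HB Require Import structures.
From mathcomp Require Import all_boot all_order all_algebra.
From mathcomp Require Import all_classical all_reals all_analysis.
From mathcomp Require Import measurable_realfun.
From mathcomp Require Import ring lra.
Import Order.TTheory GRing.Theory Num.Theory.
Import numFieldNormedType.Exports.
Set Implicit Arguments.
Unset Strict Implicit.
Unset Printing Implicit Defensive.
Local Open Scope classical_set_scope.
Local Open Scope ring_scope.

(** * The Borel sets of R^d x R^d and supports of measures *)

(** The exchange compares integrals by subtraction, while [c] has no sign and is controlled only
    near the product of [X1] and [X2]. All couplings of the two marginals are carried by one compact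
    rectangle; [c] is bounded there, so adding a constant and extending by zero yields a bounded
    nonnegative integrand and shifts all costs by the same amount. The map [x - M y] is a good chart
    because monotonicity keeps the displacements of [x] and of [M y] from pointing in nearly the
    same direction, so they cannot cancel in their difference. The tolerance [e] must beat the loss
    in recovering [y - y'] from [M (y - y')]; it is therefore fixed after the inverse of [M], the
    radius of the chart depends on [p0], and compactness of G makes the constants uniform. The norms
    at hand are sup norms, whereas inner products and the transport distance are Euclidean; each
    passage costs a factor depending on [d] only. *)

Definition open_base (T : topologicalType) (F : nat -> set T) : Prop :=
  (forall n, open (F n)) /\
  forall (O : set T) x, open O -> O x -> exists2 n, F n x & F n `<=` O.

Lemma open_base_bigcup (T : topologicalType) (F : nat -> set T) (O : set T) :
  open_base F -> open O -> O = \bigcup_(n in [set n | F n `<=` O]) F n.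
Proof.
move=> [_ baseF] oO; apply/seteqP; split=> [x Ox|x [n /= FnO]]; last exact: FnO.
by have [n Fnx FnO] := baseF _ _ oO Ox; exists n.
Qed.

(** Balls with rational centers and radii [1/(k+1)], enumerated by [pickle]; numbers that decode to
    nothing give the empty set. *)
Lemma open_base_rV (R : realType) (d : nat) :
  exists F : nat -> set 'rV[R]_d, open_base F.
Proof.
pose B (i : 'rV[rat]_d * nat) : set 'rV[R]_d :=
  ball (map_mx ratr i.1 : 'rV[R]_d) i.2.+1%:R^-1.
exists (fun n => if unpickle n is Some i then B i else set0); split=>
  [n|O x oO Ox].
  case: unpickle => [i|]; last exact: open0.
  exact/ball_open.
have /nbhs_ballP[e /= e0 eO] : nbhs x O by exact: open_nbhs_nbhs.
have [k k0 ke] : exists2 k : nat, (0 : R) < k.+1%:R^-1 & k.+1%:R^-1 < e / 2.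
  have e20 : 0 < e / 2 by rewrite divr_gt0.
  have /ltr_add_invr[k ] := e20.
  by rewrite add0r => ke; exists k.
set r : R := k.+1%:R^-1 in k0 ke.
have qP (i : 'I_d) : exists q : rat, `|x ord0 i - ratr q| < r.
  have [y [/= xy [q _ qy]]] : (ball (x ord0 i) r `&` range (@ratr R)) !=set0.
    apply: dense_rat; last exact: ball_open.
    by exists (x ord0 i); exact: ballxx.
  by exists q; rewrite qy.
have [q qx] := choice qP.
pose Q : 'rV[rat]_d := \row_i q i.
have xQ : ball (map_mx ratr Q : 'rV[R]_d) r x.
  by split=> // i j; rewrite !mxE !ord1 /ball/= distrC.
exists (pickle (Q, k)); rewrite pickleK //.
move=> y /= Qy; apply: eO; rewrite -ball_normE/=.
move: Qy xQ; rewrite /B /= -!ball_normE /= -/r => Qy Qx.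
rewrite (le_lt_trans (ler_distD (map_mx ratr Q) x y))// distrC.
by rewrite (lt_trans (ltrD Qx Qy))// [ltRHS](splitr e) ltrD.
Qed.

(** The default [(0, 0)] only repeats a member of the base, which is harmless. *)
Lemma open_base_prod (T U : topologicalType) (F : nat -> set T)
    (G : nat -> set U) (N := fun n => odflt (0, 0)%N (unpickle n)) :
  open_base F -> open_base G ->
  open_base (fun n => F (N n).1 `*` G (N n).2).
Proof.
move=> [oF bF] [oG bG]; split=> [n|O [x y] oO Oxy].
  rewrite openE => -[x y] [/= Fx Gy].
  by exists (F (N n).1, G (N n).2) => //=; split; exact: open_nbhs_nbhs.
have [[A B] /= [Ax By] ABO] : nbhs (x, y) O by exact: open_nbhs_nbhs.
have [A' [oA' A'x] A'A] : exists2 A', open A' /\ A' x & A' `<=` A.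
  by move: Ax; rewrite nbhsE => -[C [? ?] ?]; exists C.
have [B' [oB' B'y] B'B] : exists2 B', open B' /\ B' y & B' `<=` B.
  by move: By; rewrite nbhsE => -[C [? ?] ?]; exists C.
have [n Fn FA] := bF _ _ oA' A'x; have [m Gm GB] := bG _ _ oB' B'y.
exists (pickle (n, m)); rewrite /N pickleK //=.
by move=> [u v] /= [/FA/A'A ? /GB/B'B ?]; exact: ABO.
Qed.

(** The product sigma-algebra is generated by rectangles; a countable base made of rectangles is
    what brings every open set of the product into it. *)
Lemma open_base_rV2 (R : realType) (d : nat) :
  exists2 F : nat -> set ('rV[R]_d * 'rV[R]_d), open_base F &
    forall n, measurable (F n : set (borelRV R d * borelRV R d)).
Proof.
have [F bF] := @open_base_rV R d.
pose N n := odflt (0, 0)%N (unpickle n).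
exists (fun n => F (N n).1 `*` F (N n).2); first exact: open_base_prod.
by move=> n; apply: measurableX; apply: sub_sigma_algebra; exact: bF.1.
Qed.

Lemma open_measurable_rV (R : realType) (d : nat) (O : set 'rV[R]_d) :
  open O -> measurable (O : set (borelRV R d)).
Proof. exact: sub_sigma_algebra. Qed.

Lemma open_measurable_rV2 (R : realType) (d : nat)
    (O : set ('rV[R]_d * 'rV[R]_d)) :
  open O -> measurable (O : set (borelRV R d * borelRV R d)).
Proof.
move=> oO; have [F bF mF] := @open_base_rV2 R d.
by rewrite (open_base_bigcup bF oO); apply: bigcup_measurable => n _.
Qed.

Lemma closed_measurable_rV (R : realType) (d : nat) (A : set 'rV[R]_d) :
  closed A -> measurable (A : set (borelRV R d)).
Proof.
move=> cA; rewrite -(setCK A); apply: measurableC.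
by apply: open_measurable_rV; exact: closed_openC.
Qed.

Lemma closed_measurable_rV2 (R : realType) (d : nat)
    (A : set ('rV[R]_d * 'rV[R]_d)) :
  closed A -> measurable (A : set (borelRV R d * borelRV R d)).
Proof.
move=> cA; rewrite -(setCK A); apply: measurableC.
by apply: open_measurable_rV2; exact: closed_openC.
Qed.

Lemma msupport_closed (R : realType) (T : topologicalType)
    (mu : set T -> \bar R) : closed (msupport mu).
Proof.
move=> x clx A oA Ax.
have [y [supy Ay]] := clx A (open_nbhs_nbhs (conj oA Ax)).
exact: supy.
Qed.

Lemma measure_bigcup0 (R : realType) dd (T : measurableType dd)
    (mu : {measure set T -> \bar R}) (P : set nat) (F : nat -> set T) :
  (forall n, measurable (F n)) -> (forall n, P n -> mu (F n) = 0%E) ->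
  mu (\bigcup_(n in P) F n) = 0%E.
Proof.
move=> mF F0.
have : mu.-negligible (\bigcup_n (if n \in P then F n else set0)).
  apply: negligible_bigcup => n; case: ifPn => [/set_mem Pn|_].
    by apply/negligibleP; [exact: mF|exact: F0].
  exact: negligible_set0.
rewrite [X in mu.-negligible X](_ : _ = \bigcup_(n in P) F n).
  by move/negligibleP; apply; exact: bigcup_measurable.
by rewrite [RHS]bigcup_mkcond.
Qed.

(** By second countability, the complement of the support is a countable union: that of the null
    members of the base. *)
Lemma msupport_rV (R : realType) (d : nat) (mu : probability (borelRV R d) R) :
  mu (~` msupport (mu : set 'rV[R]_d -> \bar R)) = 0%E.
Proof.
have [F bF] := @open_base_rV R d.
rewrite [X in mu X](_ : _ = \bigcup_(n in [set n | mu (F n) = 0%E]) F n).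
  apply: measure_bigcup0 => // n; by apply: open_measurable_rV; exact: bF.1.
apply/seteqP; split=> [x /existsNP[A /not_implyP[oA /not_implyP[Ax muA]]]|x [n
  /= Fn0 Fnx]].
  have [n Fnx FnA] := bF.2 _ _ oA Ax; exists n => //=.
  apply: (@subset_measure0 _ (borelRV R d) R mu _ A) => //.
  - by apply: open_measurable_rV; exact: bF.1.
  - exact: open_measurable_rV.
  - by apply/eqP; rewrite eq_le measure_ge0 andbT leNgt; exact/negP.
by move=> /(_ _ (bF.1 n) Fnx); rewrite Fn0 ltxx.
Qed.

Lemma msupport_rV2 (R : realType) (d : nat)
    (mu : probability (borelRV R d * borelRV R d)%type R) :
  mu (~` msupport (mu : set ('rV[R]_d * 'rV[R]_d) -> \bar R)) = 0%E.
Proof.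
have [F bF mF] := @open_base_rV2 R d.
rewrite [X in mu X](_ : _ = \bigcup_(n in [set n | mu (F n) = 0%E]) F n).
  exact: measure_bigcup0.
apply/seteqP; split=> [x /existsNP[A /not_implyP[oA /not_implyP[Ax muA]]]|x [n
  /= Fn0 Fnx]].
  have [n Fnx FnA] := bF.2 _ _ oA Ax; exists n => //=.
  apply: (@subset_measure0 _ (borelRV R d * borelRV R d)%type R mu _ A) => //;
    first exact: open_measurable_rV2.
  by apply/eqP; rewrite eq_le measure_ge0 andbT leNgt; exact/negP.
by move=> /(_ _ (bF.1 n) Fnx); rewrite Fn0 ltxx.
Qed.

(** * Exchange of mass between two rectangles *)

Lemma probability_setC1 (R : realType) dd (T : measurableType dd)
    (P : probability T R) (A : set T) :
  measurable A -> P A = 1%E -> P (~` A) = 0%E.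
Proof. by move=> mA PA; rewrite probability_setC// PA subee. Qed.

Lemma probability_setC0 (R : realType) dd (T : measurableType dd)
    (P : probability T R) (A : set T) :
  measurable A -> P (~` A) = 0%E -> P A = 1%E.
Proof.
move=> mA PA; have := probability_setC P (measurableC mA).
by rewrite setCK PA sube0.
Qed.

Lemma probability_of_measure (R : realType) dd (T : measurableType dd)
    (mu : {measure set T -> \bar R}) : mu setT = 1%E ->
  exists P : probability T R, forall A, P A = mu A.
Proof.
move=> mu1; exists (mnormalize mu point) => A.
by rewrite /= /mnormalize mu1 onee_eq0/= invr1 mule1.
Qed.

Lemma probability_pushforward (R : realType) d1 d2 (T1 : measurableType d1)
    (T2 : measurableType d2) (P : probability T1 R) (f : T1 -> T2) :
  measurable_fun setT f ->
  exists Q : probability T2 R, Q = pushforward P f :> (set T2 -> \bar R).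
Proof.
move=> mf; pose X : {mfun T1 >-> T2} :=
  HB.pack f (isMeasurableFun.Build _ _ _ _ f mf).
by exists (distribution P X).
Qed.

(** [Q] is [P] conditioned on [W]; the product form spares a division in the extended reals. *)
Lemma probability_restr (R : realType) dd (T : measurableType dd)
    (P : probability T R) (W : set T) : measurable W -> (0 < P W)%E ->
  exists Q : probability T R, forall A, P (A `&` W) = (P W * Q A)%E.
Proof.
move=> mW PW0; exists (mnormalize (mrestr P mW) point) => A.
have PWfin : P W \is a fin_num by exact: fin_num_measure.
rewrite /= /mnormalize /= /mrestr /= setTI gt_eqF//=.
rewrite ifF; last by apply/negbTE; move: PWfin; rewrite fin_numE => /andP[].
rewrite muleCA -{1}(fineK PWfin) -EFinM divff ?mule1//.
by rewrite fine_eq0// gt_eqF.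
Qed.

Lemma integral_le_cst (R : realType) dd (T : measurableType dd)
    (P : probability T R) (W : set T) (h : T -> \bar R) (u : R) :
  measurable W -> P W = 1%E -> measurable_fun setT h ->
  (forall x, 0 <= h x)%E -> (forall x, W x -> h x <= u%:E)%E ->
  (\int[P]_x h x <= u%:E)%E.
Proof.
move=> mW PW mh h0 hu.
have PWC : P (~` W) = 0%E by exact: probability_setC1.
rewrite (ge0_negligible_integral (measurableC mW))// setTD setCK.
rewrite (@le_trans _ _ (\int[P]_(x in W) (cst u%:E x)))%E//.
  apply: ge0_le_integral => //; exact: measurable_funTS.
by rewrite integral_cst//= PW mule1.
Qed.

Lemma integral_ge_cst (R : realType) dd (T : measurableType dd)
    (P : probability T R) (W : set T) (h : T -> \bar R) (u : R) :
  measurable W -> P W = 1%E -> measurable_fun setT h ->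
  (forall x, 0 <= h x)%E -> 0 <= u -> (forall x, W x -> u%:E <= h x)%E ->
  (u%:E <= \int[P]_x h x)%E.
Proof.
move=> mW PW mh h0 u0 hu.
rewrite (@le_trans _ _ (\int[P]_(x in W) h x))%E//; last first.
  by apply: ge0_subset_integral => //; exact: measurableT.
rewrite (@le_trans _ _ (\int[P]_(x in W) (cst u%:E x)))%E//.
  by rewrite integral_cst//= PW mule1.
apply: ge0_le_integral => //; exact: measurable_funTS.
Qed.

(** The lower bounds are asked only on [K], which carries [pi] and hence its conditional laws; the
    upper bounds are asked on whole rectangles, since products of exchanged marginals need not be
    carried by [K]. The bound [H] makes the integrals finite, so that they can be subtracted. *)
Lemma coupling_swap (R : realType) d1 d2 (T1 : measurableType d1)
    (T2 : measurableType d2) (mu1 : probability T1 R) (mu2 : probability T2 R)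
    (pi : probability (T1 * T2)%type R) (K : set (T1 * T2))
    (U U' : set T1) (V V' : set T2) (h : T1 * T2 -> \bar R)
    (H lo lo' up up' : R) :
  coupling mu1 mu2 pi ->
  measurable K -> pi K = 1%E ->
  measurable U -> measurable U' -> measurable V -> measurable V' ->
  (U `*` V) `&` (U' `*` V') = set0 ->
  (0 < pi (U `*` V))%E -> (0 < pi (U' `*` V'))%E ->
  measurable_fun setT h -> (forall z, 0 <= h z)%E -> (forall z,
    h z <= H%:E)%E ->
  0 <= lo -> 0 <= lo' -> up + up' < lo + lo' ->
  (forall z, K z -> (U `*` V) z -> lo%:E <= h z)%E ->
  (forall z, K z -> (U' `*` V') z -> lo'%:E <= h z)%E ->
  (forall z, (U `*` V') z -> h z <= up%:E)%E ->
  (forall z, (U' `*` V) z -> h z <= up'%:E)%E ->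
  exists2 pi' : probability (T1 * T2)%type R, coupling mu1 mu2 pi' &
    (\int[pi']_z h z < \int[pi]_z h z)%E.
Proof.
move=> [pi1 pi2] mK piK mU mU' mV mV' dis piW0 piW'0 mh h0 hH lo0 lo'0 updown
  hlo hlo' hup hup'.
set W := U `*` V in dis piW0 hlo; set W' := U' `*` V' in dis piW'0 hlo'.
have mW : measurable W by exact: measurableX.
have mW' : measurable W' by exact: measurableX.
have [Q QE] := probability_restr mW piW0.
have [Q' Q'E] := probability_restr mW' piW'0.
have Wfin : pi W \is a fin_num by exact: fin_num_measure.
have W'fin : pi W' \is a fin_num by exact: fin_num_measure.
set m := fine (pi W); set m' := fine (pi W').
have mE : pi W = m%:E by rewrite fineK.
have m'E : pi W' = m'%:E by rewrite fineK.
have m0 : 0 < m by rewrite fine_gt0// piW0 ltey_eq Wfin.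
have m'0 : 0 < m' by rewrite fine_gt0// piW'0 ltey_eq W'fin.
(* The largest mass that both rectangles can give up. *)
pose e := Num.min m m'.
have e0 : 0 < e by rewrite lt_min m0.
have em : 0 <= m - e by rewrite subr_ge0 ge_min lexx.
have em' : 0 <= m' - e by rewrite subr_ge0 ge_min lexx orbT.
have [Q1 Q1E] := probability_pushforward Q measurable_fst.
have [Q2 Q2E] := probability_pushforward Q measurable_snd.
have [Q1' Q1'E] := probability_pushforward Q' measurable_fst.
have [Q2' Q2'E] := probability_pushforward Q' measurable_snd.
have mrest : measurable (~` (W `|` W')) by apply: measurableC; exact:
  measurableU.
pose rho := mrestr pi mrest.
pose a1 := mscale (NngNum em) Q; pose a2 := mscale (NngNum em') Q'.
pose a3 := mscale (NngNum (ltW e0)) (Q1 \x Q2')%E.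
pose a4 := mscale (NngNum (ltW e0)) (Q1' \x Q2)%E.
(* Mass [e] is taken from the conditional laws [Q] and [Q'] of [pi] on the two
   rectangles and given to the products of their exchanged marginals. *)
pose nu := measure_add (measure_add rho (measure_add a1 a2)) (measure_add a3
  a4).
have nuE A : (nu A = pi (A `&` ~` (W `|` W')) + ((m - e)%:E * Q A + (m' - e)%:E
  * Q' A)
   + (e%:E * (Q1 \x Q2') A + e%:E * (Q1' \x Q2) A))%E.
  by rewrite /nu [LHS]measure_addE; congr (_ + _)%E; rewrite [LHS]measure_addE;
    congr (_ + _)%E; rewrite [LHS]measure_addE.
have piE A : measurable A ->
    (pi A = pi (A `&` ~` (W `|` W')) + (m%:E * Q A + m'%:E * Q' A))%E.
  move=> mA; rewrite -mE -m'E -QE -Q'E.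
  have mWW : measurable (W `|` W') by exact: measurableU.
  rewrite (measureDI pi mA mWW) setDE; congr (_ + _)%E.
  rewrite setIUr measureU//; [exact: measurableI|exact: measurableI|].
  by rewrite setIACA setIid dis setI0.
have finP d0 (T : measurableType d0) (P : probability T R) A :
    measurable A -> exists p : R, P A = p%:E.
  by move=> mA; exists (fine (P A)); rewrite fineK// fin_num_measure.
have fstE A : fst @^-1` A = A `*` [set: T2] :> set (T1 * T2).
  by apply/seteqP; split=> [z|z []].
have sndE B : snd @^-1` B = [set: T1] `*` B :> set (T1 * T2).
  by apply/seteqP; split=> [z|z []].
(* The first marginals of [Q1 \x Q2'] and [Q1' \x Q2] are those of [Q] and [Q'], so the mass removed
   comes back with the same projection. *)
have marg1 A : measurable A -> nu (A `*` setT) = pi (A `*` setT).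
  move=> mA; have mAT : measurable (A `*` [set: T2]) by exact: measurableX.
  rewrite nuE (piE _ mAT) !product_measure1E//= !probability_setT !mule1 Q1E
    Q1'E.
  rewrite /pushforward fstE.
  have [p ->] := finP _ _ pi _ (measurableI _ _ mAT mrest).
  have [q ->] := finP _ _ Q _ mAT; have [q' ->] := finP _ _ Q' _ mAT.
  by rewrite -!EFinM -!EFinD; congr EFin; ring.
have marg2 B : measurable B -> nu (setT `*` B) = pi (setT `*` B).
  move=> mB; have mTB : measurable ([set: T1] `*` B) by exact: measurableX.
  rewrite nuE (piE _ mTB) !product_measure1E//= !probability_setT !mul1e Q2E
    Q2'E.
  rewrite /pushforward sndE.
  have [p ->] := finP _ _ pi _ (measurableI _ _ mTB mrest).
  have [q ->] := finP _ _ Q _ mTB; have [q' ->] := finP _ _ Q' _ mTB.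
  by rewrite -!EFinM -!EFinD; congr EFin; ring.
have nuT : nu setT = 1%E.
  by rewrite -setXTT marg1// setXTT /= probability_setT.
have [pi' pi'E] := probability_of_measure nuT.
exists pi'.
  split=> [A mA|B mB].
    by rewrite -pi1// /pushforward pi'E fstE; exact: marg1.
  by rewrite -pi2// /pushforward pi'E sndE; exact: marg2.
(* [pi] itself as a sum of measures, sharing the part [rho] with [nu]. *)
pose nu0 := measure_add rho (measure_add (mscale (NngNum (ltW m0)) Q) (mscale
  (NngNum (ltW m'0)) Q')).
have intpi : (\int[pi]_z h z = \int[rho]_z h z +
    (m%:E * \int[Q]_z h z + m'%:E * \int[Q']_z h z))%E.
  rewrite (eq_measure_integral nu0); last first.
    move=> A mA _; rewrite /= [RHS]measure_addE [X in (_ + X)%E]measure_addE.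
    exact: piE.
  by rewrite !ge0_integral_measure_add//= !ge0_integral_mscale.
have intpi' : (\int[pi']_z h z = \int[rho]_z h z +
    ((m - e)%:E * \int[Q]_z h z + (m' - e)%:E * \int[Q']_z h z) +
    (e%:E * \int[Q1 \x Q2']_z h z + e%:E * \int[Q1' \x Q2]_z h z))%E.
  rewrite (eq_measure_integral nu); last by move=> A mA _; exact: pi'E.
  by rewrite !ge0_integral_measure_add//= !ge0_integral_mscale.
have intfin (P : probability (T1 * T2)%type R) :
    exists r : R, (\int[P]_z h z)%E = r%:E.
  have leH : (\int[P]_z h z <= H%:E)%E.
    by apply: (@integral_le_cst _ _ _ P setT) => //; exact: probability_setT.
  have ge0 : (0 <= \int[P]_z h z)%E by exact: integral_ge0.
  by exists (fine (\int[P]_z h z)%E); rewrite fineK// ge0_fin_numE//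
    (le_lt_trans leH)// ltry.
have restr1 (W0 A : set (T1 * T2)) (P : probability (T1 * T2)%type R) :
    (forall A, pi (A `&` W0) = (pi W0 * P A)%E) -> (0 < pi W0)%E ->
    measurable A -> measurable W0 -> pi (A `&` W0) = pi W0 -> P A = 1%E.
  move=> -> + mA mW0; have [w ->] := finP _ _ pi _ mW0.
  have [q ->] := finP _ _ P _ mA; rewrite lte_fin -EFinM => w0 [/eqP].
  by rewrite -subr_eq0 -{2}[w]mulr1 -mulrBr mulf_eq0 gt_eqF//= subr_eq0 =>
    /eqP ->.
have piKC : pi (~` K) = 0%E by exact: probability_setC1.
have KW W0 : measurable W0 -> pi ((K `&` W0) `&` W0) = pi W0.
  move=> mW0; rewrite -setIA setIid [RHS](measureDI pi mW0 mK) setIC.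
  rewrite [X in (X + _)%E](_ : _ = 0%E) ?add0e//.
  apply: (subset_measure0 (B := ~` K)) => //; [exact: measurableD|].
  exact: measurableC.
have QW : Q (K `&` W) = 1%E.
  by apply: (restr1 W) => //; [exact: measurableI|exact: KW].
have Q'W : Q' (K `&` W') = 1%E.
  by apply: (restr1 W') => //; [exact: measurableI|exact: KW].
have UT1 (U0 : set T1) (V0 : set T2) : (U0 `*` [set:
  T2]) `&` (U0 `*` V0) = U0 `*` V0.
  by rewrite -setXI setIid setTI.
have VT1 (U0 : set T1) (V0 : set T2) : ([set:
  T1] `*` V0) `&` (U0 `*` V0) = U0 `*` V0.
  by rewrite -setXI setIid setTI.
have Q12 : (Q1 \x Q2')%E (U `*` V') = 1%E.
  rewrite product_measure1E//= Q1E Q2'E /pushforward fstE sndE.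
  rewrite (restr1 W) ?UT1//; last exact: measurableX.
  by rewrite (restr1 W') ?VT1 ?mule1//; exact: measurableX.
have Q21 : (Q1' \x Q2)%E (U' `*` V) = 1%E.
  rewrite product_measure1E//= Q1'E Q2E /pushforward fstE sndE.
  rewrite (restr1 W') ?UT1//; last exact: measurableX.
  by rewrite (restr1 W) ?VT1 ?mule1//; exact: measurableX.
have [b bE] := intfin Q; have [b' b'E] := intfin Q'.
have [x xE] := intfin (Q1 \x Q2')%E; have [x' x'E] := intfin (Q1' \x Q2)%E.
have [p pE] := intfin pi.
have lob : lo <= b.
  rewrite -lee_fin -bE; apply: (integral_ge_cst (W := K `&` W)) => //.
    exact: measurableI.
  by move=> z []; exact: hlo.
have lob' : lo' <= b'.
  rewrite -lee_fin -b'E; apply: (integral_ge_cst (W := K `&` W')) => //.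
    exact: measurableI.
  by move=> z []; exact: hlo'.
have xup : x <= up.
  rewrite -lee_fin -xE; apply: (integral_le_cst (W := U `*` V')) => //.
  exact: measurableX.
have x'up : x' <= up'.
  rewrite -lee_fin -x'E; apply: (integral_le_cst (W := U' `*` V)) => //.
  exact: measurableX.
rewrite intpi' xE x'E; move: intpi; rewrite pE bE b'E.
(* Infinite values are excluded because the integral against [pi] is the real [p]. The cost then
   drops by [e * (b + b' - x - x')], which is at least [e * (lo + lo' - up - up') > 0]. *)
case: (\int[rho]_z h z)%E => [r| |]//.
rewrite -!EFinM -!EFinD lte_fin => -[->].
by nra.
Qed.

(** * Monotonicity of the support of an optimal plan *)

(** Outside [D] the function is arbitrary and the preimage of an open ray need not be open, but its
    interior has the same trace on [D]. *)
Lemma continuous_measurable_rV2 (R : realType) (d : nat)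
    (D : set ('rV[R]_d * 'rV[R]_d)) (c : 'rV[R]_d * 'rV[R]_d -> R) :
  (forall z, D z -> {for z, continuous c}) ->
  measurable_fun (D : set (borelRV R d * borelRV R d)) c.
Proof.
move=> cD mD; apply: (measurability _ (RGenOInfty.measurableE R)) => //.
move=> _ [_ [a ->] <-].
rewrite (_ : _ `&` _ = D `&` interior (c @^-1` `]a, +oo[%classic)).
  apply: measurableI => //; apply: open_measurable_rV2; exact: open_interior.
apply/seteqP; split=> z [Dz caz]; split=> //; last exact: interior_subset caz.
apply: cD => //; apply: open_nbhs_nbhs; split=> //.
Qed.

Lemma coupling_setX (R : realType) d1 d2 (T1 : measurableType d1)
    (T2 : measurableType d2) (mu1 : probability T1 R) (mu2 : probability T2 R)
    (pi : probability (T1 * T2)%type R) (A : set T1) (B : set T2) :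
  coupling mu1 mu2 pi -> measurable A -> measurable B ->
  mu1 (~` A) = 0%E -> mu2 (~` B) = 0%E -> pi (~` (A `*` B)) = 0%E.
Proof.
move=> [pi1 pi2] mA mB A1 B1.
have mA' : measurable (~` A `*` [set: T2]) by apply: measurableX => //; exact:
  measurableC.
have mB' : measurable ([set: T1] `*` ~` B) by apply: measurableX => //; exact:
  measurableC.
apply: (subset_measure0 (B := (~` A `*` [set: T2]) `|` ([set: T1] `*` ~` B))).
- by apply: measurableC; exact: measurableX.
- exact: measurableU.
- move=> [x y] /= ABxy; have [Ax|Ax] := pselect (A x); last by left.
  by right; split=> // By; exact: ABxy.
- apply: null_set_setU => //.
  + rewrite -(pi1 _ (measurableC mA)) in A1; rewrite -A1 /pushforward.
    by congr (pi _); apply/seteqP; split=> [z []|z].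
  + rewrite -(pi2 _ (measurableC mB)) in B1; rewrite -B1 /pushforward.
    by congr (pi _); apply/seteqP; split=> [z []|z].
Qed.

(** Turns the cost into the integral of a nonnegative function on the whole space, the form required
    by [coupling_swap]. The shift [B] does not depend on the plan, so comparisons of costs are
    preserved. *)
Lemma transport_cost_shift (R : realType) (d : nat) (X1 X2 : set 'rV[R]_d)
    (c : 'rV[R]_d * 'rV[R]_d -> R) (K : set ('rV[R]_d * 'rV[R]_d)) (B : R)
    (pi : probability (borelRV R d * borelRV R d)%type R) :
  closed X1 -> closed X2 ->
  (forall z, (X1 `*` X2) z -> {for z, continuous c}) ->
  closed K -> K `<=` X1 `*` X2 -> pi (~` K) = 0%E ->
  (forall z, K z -> `|c z| <= B) ->
  (transport_cost X1 X2 c pi + B%:E =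
   \int[pi]_z ((fun z => (c z + B)%:E) \_ K) z)%E.
Proof.
move=> cX1 cX2 cc cK KX piK cB.
have mK : measurable (K : set (borelRV R d * borelRV R d)).
  exact: closed_measurable_rV2.
have mX : measurable (X1 `*` X2 : set (borelRV R d * borelRV R d)).
  by apply: measurableX; exact: closed_measurable_rV.
have mc := continuous_measurable_rV2 cc.
have mcK : measurable_fun (K : set (borelRV R d * borelRV R d)) c.
  by apply: continuous_measurable_rV2 => z /KX; exact: cc.
have mXK : measurable ((X1 `*` X2) `\` K : set (borelRV R d * borelRV R d)).
  exact: measurableD.
have XK0 : pi ((X1 `*` X2) `\` K) = 0%E.
  apply: (@subset_measure0 _ (borelRV R d * borelRV R d)%type R pi _ (~` K)) =>
    //.
  exact: measurableC.
have XXK : (X1 `*` X2) `\` ((X1 `*` X2) `\` K) = K.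
  by rewrite setDD setIidr.
have intK : pi.-integrable K (EFin \o c).
  apply: measurable_bounded_integrable => //.
    by rewrite (le_lt_trans (probability_le1 _ _))// ltry.
  exists B; split=> [|y By]; first exact: num_real.
  by move=> z Kz /=; rewrite (le_trans (cB z Kz))// ltW.
have mcE : measurable_fun (X1 `*` X2 :
  set (borelRV R d * borelRV R d)) (EFin \o c).
  exact/measurable_EFinP.
have intX : pi.-integrable (X1 `*` X2) (EFin \o c).
  by apply/(negligible_integrable mXK) => //; rewrite XXK.
rewrite /transport_cost (negligible_integral mXK)// XXK -integral_mkcond.
have BE : (B%:E = \int[pi]_(z in K) (EFin \o cst B) z)%E.
  by rewrite (integral_cst _ mK B%:E) /= (probability_setC0 mK piK) mule1.
rewrite [X in (_ + X)%E]BE -integralD_EFin//.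
exact: finite_measure_integrable_cst.
Qed.

Lemma msupport_setC0 (R : realType) (d : nat) (mu : probability (borelRV R d) R)
    (A : set 'rV[R]_d) : closed A -> mu A = 1%E ->
  mu (~` (A `&` msupport (mu : set 'rV[R]_d -> \bar R))) = 0%E.
Proof.
move=> cA muA; rewrite setCI.
have mA : measurable (A : set (borelRV R d)) by exact: closed_measurable_rV.
apply: null_set_setU.
- exact: measurableC.
- by apply: measurableC; apply: closed_measurable_rV; exact: msupport_closed.
- exact: probability_setC1.
- exact: msupport_rV.
Qed.

(** The strip over a neighborhood of [x] is a neighborhood of [(x, y)], and its mass is that of its
    base under [mu1]; likewise for [y]. *)
Lemma coupling_msupport (R : realType) (d : nat) (X1 X2 : set 'rV[R]_d)
    (mu1 mu2 : probability (borelRV R d) R)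
    (pi : probability (borelRV R d * borelRV R d)%type R) :
  closed X1 -> closed X2 -> mu1 X1 = 1%E -> mu2 X2 = 1%E ->
    coupling mu1 mu2 pi ->
  msupport (pi : set ('rV[R]_d * 'rV[R]_d) -> \bar R) `<=`
  (X1 `&` msupport (mu1 : set 'rV[R]_d -> \bar R)) `*`
  (X2 `&` msupport (mu2 : set 'rV[R]_d -> \bar R)).
Proof.
move=> cX1 cX2 muX1 muX2 [pi1 pi2] [x y] suppxy /=.
have pos1 A : open A -> A x -> (0 < mu1 A)%E.
  move=> oA Ax; rewrite -pi1; last exact: open_measurable_rV.
  apply: suppxy => //; apply: open_comp => // z _; exact: cvg_fst.
have pos2 A : open A -> A y -> (0 < mu2 A)%E.
  move=> oA Ay; rewrite -pi2; last exact: open_measurable_rV.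
  apply: suppxy => //; apply: open_comp => // z _; exact: cvg_snd.
split; split=> //.
  apply: contrapT => X1x; have := pos1 _ (closed_openC cX1) X1x.
  by rewrite probability_setC1 ?ltxx//; exact: closed_measurable_rV.
apply: contrapT => X2y; have := pos2 _ (closed_openC cX2) X2y.
by rewrite probability_setC1 ?ltxx//; exact: closed_measurable_rV.
Qed.

Lemma optimal_transport_monotone (R : realType) (d : nat) (X1 X2 : set 'rV[R]_d)
    (c : 'rV[R]_d * 'rV[R]_d -> R) (mu1 mu2 : probability (borelRV R d) R)
    (pi : probability (borelRV R d * borelRV R d)%type R)
    (G := msupport (pi : set ('rV[R]_d * 'rV[R]_d) -> \bar R)) :
  closed X1 -> closed X2 -> mu1 X1 = 1%E -> mu2 X2 = 1%E ->
  compact (msupport (mu1 : set 'rV[R]_d -> \bar R)) ->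
  compact (msupport (mu2 : set 'rV[R]_d -> \bar R)) ->
  (forall z, (X1 `*` X2) z -> {for z, continuous c}) ->
  optimal_transport X1 X2 c mu1 mu2 pi ->
  forall p q, G p -> G q -> c p + c q <= c (p.1, q.2) + c (q.1, p.2).
Proof.
move=> cX1 cX2 muX1 muX2 K1 K2 cc [cpl opt] [x y] [x' y'] Gp Gq /=.
set S1 := msupport _ in K1; set S2 := msupport _ in K2.
(* This rectangle carries every coupling, the competitor included, and it contains the exchanged
   points [(x, y')] and [(x', y)]. *)
pose K := (X1 `&` S1) `*` (X2 `&` S2).
have GK : G `<=` K by exact: coupling_msupport.
have KX : K `<=` X1 `*` X2 by move=> z [[? _] [? _]].
have cptK : compact K.
  by apply: compact_setX; rewrite setIC; exact: compact_closedI.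
have cK : closed K by apply: compact_closed => //; exact: norm_hausdorff.
have mK : measurable (K : set (borelRV R d * borelRV R d)).
  exact: closed_measurable_rV2.
have cplK g : coupling mu1 mu2 g -> g (~` K) = 0%E.
  move=> cplg; apply: (coupling_setX cplg).
  - by apply: closed_measurable_rV; apply: closedI => //; exact:
    msupport_closed.
  - by apply: closed_measurable_rV; apply: closedI => //; exact:
    msupport_closed.
  - exact: msupport_setC0.
  - exact: msupport_setC0.
have [B0 cB0] : exists B0, forall z, K z -> `|c z| <= B0.
  have [M [_ hM]] : bounded_set (c @` K).
    apply: compact_bounded; apply: continuous_compact => //.
    by apply: continuous_in_subspaceT => z /set_mem /KX; exact: cc.
  by exists (M + 1) => z Kz; apply: (hM (M + 1)); [rewrite ltrDl|exists z].
rewrite leNgt; apply/negP => Delta0.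
set D := c (x, y) + c (x', y') - (c (x, y') + c (x', y)).
have D0 : 0 < D by rewrite subr_gt0.
(* [D] is the defect of monotonicity; oscillations below [D / 5] around the four points add up to
   less than [D]. *)
have cont z : (X1 `*` X2) z -> exists2 r, 0 < r &
    forall u v, `|z.1 - u| < r -> `|z.2 - v| < r -> `|c z - c (u, v)| < D / 5.
  move=> /cc /cvgr_dist_lt /(_ (D / 5)) []; first by rewrite divr_gt0.
  move=> [A1 A2] /= [/nbhs_ballP[r1 /= r10 rA1] /nbhs_ballP[r2 /= r20 rA2]] A12.
  exists (Num.min r1 r2); first by rewrite lt_min r10.
  move=> u v; rewrite !lt_min => /andP[ur1 _] /andP[_ vr2].
  by apply: (A12 (u, v)); split; [apply: rA1|apply: rA2]; rewrite -ball_normE.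
have [[X1x S1x] [X2y S2y]] := GK _ Gp.
have [[X1x' S1x'] [X2y' S2y']] := GK _ Gq.
have [r1 r10 hr1] := cont (x, y) (conj X1x X2y).
have [r2 r20 hr2] := cont (x', y') (conj X1x' X2y').
have [r3 r30 hr3] := cont (x, y') (conj X1x X2y').
have [r4 r40 hr4] := cont (x', y) (conj X1x' X2y).
(* If [x = x'], the defect [D] vanishes. Radii below half this distance make the two rectangles
   disjoint. *)
have xx' : 0 < `|x - x'|.
  rewrite normr_gt0 subr_eq0; apply/eqP => xx'.
  by move: D0; rewrite /D xx' [X in _ - X]addrC subrr ltxx.
pose r := Num.min (`|x - x'| / 2) (Num.min (Num.min r1 r2) (Num.min r3 r4)).
have r0 : 0 < r by rewrite !lt_min r10 r20 r30 r40 divr_gt0.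
have rP (u : R) : u < r -> [/\ u < `|x - x'| / 2, u < r1, u < r2,
  u < r3 & u < r4].
  by rewrite !lt_min => /andP[-> /andP[/andP[-> ->] /andP[-> ->]]].
pose N (z : 'rV[R]_d) : set 'rV[R]_d := [set w | `|z - w| < r].
have oN z : open (N z).
  by rewrite (_ : N z = ball z r); [exact: ball_open|rewrite -ball_normE].
have Nz z : N z z by rewrite /N /= subrr normr0.
have mN z : measurable (N z : set (borelRV R d)) by exact: open_measurable_rV.
(* With this shift [c + B >= D] on [K]: the lower bounds stay nonnegative after subtracting [D / 5],
   and the upper bounds remain valid off [K], where [h] is zero. *)
pose B := B0 + D.
pose h z := ((fun z => (c z + B)%:E) \_ K) z.
have hK z : K z -> h z = (c z + B)%:E by move=> Kz; rewrite /h patchE mem_set.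
have hNK z : ~ K z -> h z = 0%E by move=> Kz; rewrite /h patchE memNset.
have cB z : K z -> D <= c z + B.
  by move=> /cB0; rewrite ler_norml /B => /andP[]; lra.
have posN u v : G (u, v) -> (0 < pi (N u `*` N v))%E.
  move=> Guv; apply: Guv; last by split; exact: Nz.
  rewrite openE => -[a b] [/= Na Nb].
  by exists (N u, N v) => //=; split; apply: open_nbhs_nbhs.
have [||||||||||||||||||pi' cpl' lt'] :=
  @coupling_swap R _ _ (borelRV R d) (borelRV R d) mu1 mu2 pi K
  (N x) (N x') (N y) (N y') h (B0 + B)
  (c (x, y) + B - D / 5) (c (x', y') + B - D / 5)
  (c (x, y') + B + D / 5) (c (x', y) + B + D / 5) cpl mK.
- apply: probability_setC0 => //; exact: cplK.
- exact: mN.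
- exact: mN.
- exact: mN.
- exact: mN.
- apply/seteqP; split=> //
  -[u v] [[/= /rP[xu _ _ _ _] _] [/= /rP[x'u _ _ _ _] _]].
  have := ler_distD u x x'; rewrite (distrC u); lra.
- exact: posN.
- exact: posN.
- apply/(measurable_restrict _ mK measurableT); rewrite setTI.
  apply/measurable_EFinP; apply: measurable_funD => //.
  by apply: continuous_measurable_rV2 => z /KX; exact: cc.
- move=> z; have [Kz|/hNK ->//] := pselect (K z); rewrite hK// lee_fin.
  by rewrite (le_trans _ (cB _ Kz))// ltW.
- move=> z; have [Kz|/hNK ->//] := pselect (K z).
    by rewrite hK// lee_fin lerD2r (le_trans (ler_norm _))// cB0.
  rewrite lee_fin; have := cB0 _ (GK _ Gp); have := normr_ge0 (c (x, y)).
  by rewrite /B; lra.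
- have := cB _ (GK _ Gp); lra.
- have := cB _ (GK _ Gq); lra.
- by rewrite /D in D0 *; lra.
- move=> [u v] Kz [/= /rP[_ ux _ _ _] /rP[_ vy _ _ _]]; rewrite hK// lee_fin.
  by have := hr1 u v ux vy; rewrite ltr_norml => /andP[]; lra.
- move=> [u v] Kz [/= /rP[_ _ ux _ _] /rP[_ _ vy _ _]]; rewrite hK// lee_fin.
  by have := hr2 u v ux vy; rewrite ltr_norml => /andP[]; lra.
- move=> [u v] [/= /rP[_ _ _ ux _] /rP[_ _ _ vy _]].
  have [Kz|/hNK ->] := pselect (K (u, v)); rewrite ?hK// lee_fin.
    by have := hr3 u v ux vy; rewrite ltr_norml => /andP[]; lra.
  have := cB (x, y') (conj (conj X1x S1x) (conj X2y' S2y')); lra.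
- move=> [u v] [/= /rP[_ _ _ _ ux] /rP[_ _ _ _ vy]].
  have [Kz|/hNK ->] := pselect (K (u, v)); rewrite ?hK// lee_fin.
    by have := hr4 u v ux vy; rewrite ltr_norml => /andP[]; lra.
  have := cB (x', y) (conj (conj X1x' S1x') (conj X2y S2y)); lra.
have cBK z : K z -> `|c z| <= B by move=> /cB0; rewrite /B; lra.
have := opt _ cpl'; rewrite leNgt => /negP; apply.
have := lt'.
rewrite -(transport_cost_shift cX1 cX2 cc cK KX (cplK _ cpl) cBK).
rewrite -(transport_cost_shift cX1 cX2 cc cK KX (cplK _ cpl') cBK).
by rewrite lteD2rE.
Qed.

(** * Second order mean value theorem and local Lipschitz parametrization *)

Lemma rV_coord_norm_le (R : realType) (d : nat) (x : 'rV[R]_d) (i : 'I_d) :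
  `|x 0 i| <= `|x|.
Proof.
by rewrite [leRHS]/Num.Def.normr /= mx_normrE; exact: (le_bigmax _ (fun ij =>
  `|x ij.1 ij.2|) (ord0, i)).
Qed.

Lemma rV_norm_le (R : realType) (d : nat) (x : 'rV[R]_d) (e : R) :
  0 <= e -> (forall i, `|x 0 i| <= e) -> `|x| <= e.
Proof.
move=> e0 xe; rewrite [leLHS]/Num.Def.normr /= mx_normrE.
by apply: bigmax_le => // -[i j] _ /=; rewrite ord1.
Qed.

Lemma mulmx_norm_le (R : realType) (d : nat) (N : 'M[R]_d) :
  exists2 K : R, 0 < K & forall w : 'rV[R]_d, `|w *m N| <= K * `|w|.
Proof.
pose S := \sum_i \sum_j `|N i j|.
have S0 : 0 <= S by apply: sumr_ge0 => i _; exact: sumr_ge0.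
exists (S + 1) => [|w]; first by rewrite ltr_wpDl.
apply: rV_norm_le => [|j]; first by rewrite mulr_ge0// addr_ge0.
rewrite mxE (le_trans (ler_norm_sum _ _ _))//.
rewrite (@le_trans _ _ (S * `|w|))//; last by rewrite ler_wpM2r// lerDl.
rewrite mulr_suml; apply: ler_sum => i _; rewrite normrM mulrC.
rewrite ler_pM ?rV_coord_norm_le//.
by rewrite (bigD1 j)//= lerDl sumr_ge0.
Qed.

Lemma is_derive_line (R : realType) (V : normedModType R) (f : V -> R)
    (a v : V) (t : R) :
  differentiable f (a + t *: v) ->
  is_derive t 1 (fun s => f (a + s *: v)) ('D_v f (a + t *: v)).
Proof.
move=> df.
have quotE : (fun h : R => h^-1 *: (((fun s => f (a + s *: v)) \o shift t) (h *:
  (1 : R)) - f (a + t *: v))) =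
    (fun h : R => h^-1 *: ((f \o shift (a + t *: v)) (h *: v) - f (a + t *:
      v))).
  apply/funext => h /=; congr (_ *: (f _ - _)).
  by rewrite /= [h *: (1 : R)]mulr1 scalerDl addrCA.
split.
  by rewrite /derivable quotE; exact: diff_derivable.
by rewrite /derive quotE.
Qed.

Lemma MVT01 (R : realType) (f df : R -> R) :
  (forall t : R, 0 <= t <= 1 -> is_derive t 1 f (df t)) ->
  exists2 t : R, 0 <= t <= 1 & f 1 - f 0 = df t.
Proof.
move=> fdf.
have [t] : exists2 t : R, t \in `]0, 1[%R & f 1 - f 0 = df t * (1 - 0).
  apply: MVT => //.
    by move=> x; rewrite in_itv/= => /andP[x0 x1]; apply: fdf; rewrite !ltW.
  apply: derivable_within_continuous => x; rewrite in_itv/= => x01.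
  by have [] := fdf x x01.
by rewrite in_itv/= subr0 mulr1 => /andP[t0 t1] ?; exists t => //; rewrite !ltW.
Qed.

(** [D2xy] is made of derivatives along basis vectors, while the mean value theorem differentiates
    along a segment; linearity of the differential links the two. *)
Lemma derive_pairr (R : realType) (d : nat) (f : 'rV[R]_d * 'rV[R]_d -> R)
    (p : 'rV[R]_d * 'rV[R]_d) (w : 'rV[R]_d) : differentiable f p ->
  'D_((0 : 'rV[R]_d, w)) f p =
  \sum_(j < d) w 0 j * 'D_((0 : 'rV[R]_d, delta_mx 0 j : 'rV[R]_d)) f p.
Proof.
move=> df; rewrite deriveE// [in LHS](row_sum_delta w).
rewrite (big_morph (fun w : 'rV[R]_d => 'd f p (0 : 'rV[R]_d, w)) (id1 :=
  0) (op1 := +%R)).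
- apply: eq_bigr => j _; rewrite deriveE// -[RHS]linearZ.
  by congr ('d f p _); congr pair; rewrite scaler0.
- move=> a b; rewrite -linearD; congr ('d f p _); congr pair.
  by rewrite addr0.
- exact: linear0.
Qed.

Lemma derive_pairl (R : realType) (d : nat) (f : 'rV[R]_d * 'rV[R]_d -> R)
    (p : 'rV[R]_d * 'rV[R]_d) (w : 'rV[R]_d) : differentiable f p ->
  'D_((w, 0 : 'rV[R]_d)) f p =
  \sum_(j < d) w 0 j * 'D_((delta_mx 0 j : 'rV[R]_d, 0 : 'rV[R]_d)) f p.
Proof.
move=> df; rewrite deriveE// [in LHS](row_sum_delta w).
rewrite (big_morph (fun w : 'rV[R]_d => 'd f p (w, 0 : 'rV[R]_d)) (id1 :=
  0) (op1 := +%R)).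
- apply: eq_bigr => j _; rewrite deriveE// -[RHS]linearZ.
  by congr ('d f p _); congr pair; rewrite scaler0.
- move=> a b; rewrite -linearD; congr ('d f p _); congr pair.
  by rewrite addr0.
- exact: linear0.
Qed.

(** The one-variable mean value theorem is used twice, first along the segment in [y] for the
    difference in [x], then along the segment in [x] for the resulting derivative. Both functions
    are scalar, so a single point [(s, t)] serves all entries of [D2xy]. *)
Lemma mixed_difference_MVT (R : realType) (d : nat)
    (c : 'rV[R]_d * 'rV[R]_d -> R) (x x' y y' : 'rV[R]_d) :
  (forall s t : R, 0 <= s <= 1 -> 0 <= t <= 1 ->
    differentiable c (x' + s *: (x - x'), y' + t *: (y - y')) /\
    forall v, differentiable ('D_v c) (x' + s *: (x - x'), y' + t *:
      (y - y'))) ->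
  exists s t : R, [/\ 0 <= s <= 1, 0 <= t <= 1 &
    c (x, y) - c (x', y) - (c (x, y') - c (x', y')) =
    \sum_(i < d) \sum_(j < d) (x - x') 0 i * (y - y') 0 j *
      D2xy c (x' + s *: (x - x'), y' + t *: (y - y')) i j].
Proof.
move=> dc; pose u := x - x'; pose w := y - y'.
pose ej j : 'rV[R]_d * 'rV[R]_d := (0, delta_mx 0 j).
have lineE (a b : 'rV[R]_d) (t : R) : (a, b) + t *: (0 : 'rV[R]_d, w) = (a,
  b + t *: w).
  by congr pair; rewrite /= scaler0 addr0.
have lineE' (a b : 'rV[R]_d) (s : R) : (a, b) + s *: (u, 0 :
  'rV[R]_d) = (a + s *: u, b).
  by congr pair; rewrite /= scaler0 addr0.
have xE : x' + 1 *: u = x by rewrite scale1r addrC subrK.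
have x'E : x' + 0 *: u = x' by rewrite scale0r addr0.
have yE : y' + 1 *: w = y by rewrite scale1r addrC subrK.
have y'E : y' + 0 *: w = y' by rewrite scale0r addr0.
have I0 : 0 <= (0 : R) <= 1 by rewrite lexx ler01.
have I1 : 0 <= (1 : R) <= 1 by rewrite lexx ler01.
have [|t t01 tE] := @MVT01 R (fun t => c (x, y' + t *: w) - c (x', y' + t *: w))
  (fun t => \sum_(j < d) w 0 j * ('D_(ej j) c (x, y' + t *:
    w) - 'D_(ej j) c (x', y' + t *: w))).
  move=> t t01.
  have dl a : differentiable c (a, y' + t *: w) ->
      is_derive t 1 (fun t => c (a, y' + t *:
        w)) (\sum_(j < d) w 0 j * 'D_(ej j) c (a, y' + t *: w)).
    move=> da; rewrite -derive_pairr// -lineE.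
    rewrite (_ : (fun t => _) = (fun t : R => c ((a, y') + t *: (0 : 'rV[R]_d,
      w)))).
      by apply: is_derive_line; rewrite lineE.
    by apply/funext => r; rewrite lineE.
  apply: is_derive_eq.
    apply: is_deriveB; apply: dl.
      by have [+ _] := dc 1 t I1 t01; rewrite xE.
    by have [+ _] := dc 0 t I0 t01; rewrite x'E.
  by rewrite -sumrB; apply: eq_bigr => j _; rewrite mulrBr.
have [|s s01 sE] := @MVT01 R (fun s =>
  \sum_(j < d) w 0 j * 'D_(ej j) c (x' + s *: u, y' + t *: w))
  (fun s => \sum_(j < d) w 0 j * \sum_(i < d) u 0 i *
     D2xy c (x' + s *: u, y' + t *: w) i j).
  move=> s s01; rewrite [X in is_derive _ _ X](_ : _ =
      \sum_(j < d) (w 0 j \*: (fun s => 'D_(ej j) c (x' + s *: u, y' + t *: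
        w)))); last first.
    by apply/funext => r; rewrite fct_sumE.
  apply: is_derive_sum => j; apply: is_deriveZ.
  have [_ dD] := dc s t s01 t01.
  rewrite (_ : \sum_(i < d) _ = 'D_((u, 0 : 'rV[R]_d)) ('D_(ej j) c) (x' + s *:
    u, y' + t *: w)).
    rewrite -lineE'.
    rewrite (_ : (fun s => _) = (fun s : R => 'D_(ej j) c ((x', y' + t *:
      w) + s *: (u, 0 : 'rV[R]_d)))).
      by apply: is_derive_line; rewrite lineE'; exact: dD.
    by apply/funext => r; rewrite lineE'.
  rewrite derive_pairl; last exact: dD.
  by apply: eq_bigr => i _; rewrite [X in _ * X = _]mxE.
exists s, t; split=> //.
rewrite {}yE {}y'E in tE; rewrite {}xE {}x'E in sE.
rewrite tE; transitivity (\sum_(j < d) w 0 j * 'D_(ej j) c (x, y' + t *: w) -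
    \sum_(j < d) w 0 j * 'D_(ej j) c (x', y' + t *: w)).
  by rewrite -sumrB; apply: eq_bigr => j _; rewrite mulrBr.
rewrite sE [RHS]exchange_big; apply: eq_bigr => j _ /=.
by rewrite mulr_sumr; apply: eq_bigr => i _; rewrite mulrCA mulrA.
Qed.

Lemma C2_mixed_difference (R : realType) (d : nat)
    (c : 'rV[R]_d * 'rV[R]_d -> R) (U : set ('rV[R]_d * 'rV[R]_d))
    (x0 y0 : 'rV[R]_d) (e : R) :
  open U -> U (x0, y0) -> C2_on U c -> 0 < e ->
  exists2 r : R, 0 < r & forall x x' y y' : 'rV[R]_d,
    `|x0 - x| < r -> `|x0 - x'| < r -> `|y0 - y| < r -> `|y0 - y'| < r ->
    `|c (x, y) - c (x', y) - (c (x, y') - c (x', y')) -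
      \sum_(i < d) \sum_(j < d) (x - x') 0 i * (y - y') 0 j *
        D2xy c (x0, y0) i j| <= e * `|x - x'| * `|y - y'|.
Proof.
move=> oU U0 [C1c C1Dc] e0.
(* The double sum has [d * d] terms; the successor avoids dividing by zero. *)
pose e' := e / (d * d).+1%:R.
have e'0 : 0 < e' by rewrite divr_gt0.
have nU : \forall q \near (x0, y0), U q by exact: open_nbhs_nbhs.
have nD : \forall q \near (x0, y0), forall i j : 'I_d,
    `|D2xy c (x0, y0) i j - D2xy c q i j| < e'.
  have F := @nbhs_filter ('rV[R]_d * 'rV[R]_d)%type (x0, y0).
  apply: (@filter_forall _ _ (fun i q => forall j,
    `|_ - D2xy c q i j| < _) _ F) => i.
  apply: (@filter_forall _ _ (fun j q => `|_ - D2xy c q i j| < _) _ F) => j.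
  have [_ /(_ (delta_mx 0 i, 0)) cont] := C1Dc (0, delta_mx 0 j) _ U0.
  have Hc := @cvgr_dist_lt _ _ _ _ _ _ _ cont _ e'0.
  by apply: (@filterS _ _ F _ _ _ (Hc F)) => q /=; rewrite !mxE.
have near_p := filterI nU nD.
have [[A B] /= [/nbhs_ballP[r1 /= r10 rA] /nbhs_ballP[r2 /= r20 rB]] AB] :=
  near_p.
exists (Num.min r1 r2); first by rewrite lt_min r10.
move=> x x' y y'; rewrite !lt_min =>
  /andP[x1 _] /andP[x'1 _] /andP[_ y2] /andP[_ y'2].
(* Balls are convex, so the intermediate points remain where [D2xy] is within [e'] of its value at
   the center. *)
have conv (a b b' : 'rV[R]_d) (r t : R) : 0 <= t <= 1 -> `|a - b| < r ->
  `|a - b'| < r ->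
    ball a r (b' + t *: (b - b')).
  move=> /andP[t0 t1] ab ab'; rewrite -ball_normE /=.
  rewrite (_ : a - _ = t *: (a - b) + (1 - t) *: (a - b')); last first.
    by apply/rowP => k; rewrite !mxE; ring.
  pose m := Num.max `|a - b| `|a - b'|.
  have mr : m < r by rewrite gt_max ab.
  rewrite (le_lt_trans _ mr)// (le_trans (ler_normD _ _))// !normrZ.
  rewrite ger0_norm// ger0_norm ?subr_ge0//.
  have -> : m = t * m + (1 - t) * m by ring.
  by apply: lerD; apply: ler_wpM2l; rewrite ?subr_ge0// le_max lexx ?orbT.
have inN s t : 0 <= s <= 1 -> 0 <= t <= 1 ->
    U (x' + s *: (x - x'), y' + t *: (y - y')) /\ forall i j : 'I_d,
    `|D2xy c (x0, y0) i j - D2xy c (x' + s *: (x - x'), y' + t *: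
      (y - y')) i j| < e'.
  by move=> s01 t01; apply: AB; split; [apply: rA|apply: rB]; exact: conv.
have [|s [t [s01 t01 ->]]] := @mixed_difference_MVT R d c x x' y y'.
  move=> s t s01 t01; have [Uq _] := inN s t s01 t01; split.
    by have [] := C1c _ Uq.
  by move=> v; have [] := C1Dc v _ Uq.
have [_ De] := inN s t s01 t01.
rewrite -sumrB; under eq_bigr do rewrite -sumrB.
rewrite (le_trans (ler_norm_sum _ _ _))//.
rewrite (@le_trans _ _ (\sum_(i < d) \sum_(j < d) (`|x - x'| * `|y - y'| *
  e')))//.
  apply: ler_sum => i _; rewrite (le_trans (ler_norm_sum _ _ _))//.
  apply: ler_sum => j _; rewrite -mulrBr !normrM.
  apply: ler_pM; rewrite ?mulr_ge0//.
    by apply: ler_pM => //; exact: rV_coord_norm_le.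
  by rewrite distrC ltW.
rewrite !sumr_const card_ord -mulrnA.
rewrite -mulr_natr /e' mulrA mulrAC.
rewrite ler_pdivrMr// (_ : e * _ * _ = `|x - x'| * `|y - y'| * e); last by ring.
by rewrite ler_wpM2l ?ler_nat// !mulr_ge0// ltW.
Qed.

Lemma sum_sqr_le_norm (R : realType) (d : nat) (x : 'rV[R]_d) :
  \sum_(i < d) x 0 i ^+ 2 <= d%:R * `|x| ^+ 2.
Proof.
rewrite (@le_trans _ _ (\sum_(i < d) `|x| ^+ 2))//; last first.
  by rewrite sumr_const card_ord mulr_natl.
apply: ler_sum => i _; rewrite -real_normK ?num_real//.
by rewrite lerXn2r ?nnegrE// rV_coord_norm_le.
Qed.

Lemma norm_sqr_le_sum (R : realType) (d : nat) (x : 'rV[R]_d) :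
  `|x| ^+ 2 <= \sum_(i < d) x 0 i ^+ 2.
Proof.
have S0 : 0 <= \sum_(i < d) x 0 i ^+ 2 by apply: sumr_ge0 => i _; exact:
  sqr_ge0.
rewrite -[leRHS]sqr_sqrtr// lerXn2r ?nnegrE ?sqrtr_ge0//.
apply: rV_norm_le => [|i]; first exact: sqrtr_ge0.
rewrite -sqrtr_sqr ler_wsqrtr// (bigD1 i)//= lerDl.
by apply: sumr_ge0 => j _; exact: sqr_ge0.
Qed.

(* If [u . v] is small compared with [|u| |v|], then [u - v] controls both
   vectors, since [|u - v|^2 = |u|^2 + |v|^2 - 2 u . v]. *)
Lemma norm_le_sub (R : realType) (d : nat) (u v : 'rV[R]_d) : (0 < d)%N ->
  \sum_(i < d) u 0 i * v 0 i <= 4^-1 * (`|u| * `|v|) ->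
  `|u| <= d%:R * 2 * `|u - v| /\ `|v| <= d%:R * 2 * `|u - v|.
Proof.
move=> d0 uv.
have d1 : 1 <= d%:R :> R by rewrite ler1n.
have := norm_sqr_le_sum u; have := norm_sqr_le_sum v; have :=
  sum_sqr_le_norm (u - v).
have -> : \sum_(i < d) (u - v) 0 i ^+ 2 =
    \sum_(i < d) u 0 i ^+ 2 + \sum_(i < d) v 0 i ^+ 2 - 2 * \sum_(i < d) u 0 i
      * v 0 i.
  rewrite mulr_sumr -big_split/= -sumrB; apply: eq_bigr => i _.
  by rewrite !mxE; ring.
have := normr_ge0 u; have := normr_ge0 v; have := normr_ge0 (u - v).
move: uv; move: `|u| `|v| `|u - v| (\sum_(i < d) _) (\sum_(i < d) _) (\sum_(i <
  d) _).
move=> a b s ab A B s0 b0 a0 habs hs hb ha.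
(* Twice the inner product is at most [a * b / 2], hence at most a quarter of [a ^+ 2 + b ^+ 2];
   three quarters of this sum are thus bounded by [d%:R * s ^+ 2]. *)
have sq : a ^+ 2 + b ^+ 2 <= d%:R * 2 * s ^+ 2 by nra.
have sq' : d%:R * 2 * s ^+ 2 <= (d%:R * 2 * s) ^+ 2.
  by rewrite exprMn ler_wpM2r ?sqr_ge0//; nra.
split; rewrite -(@ler_pXn2r _ 2)// ?nnegrE ?mulr_ge0//; first by have :=
  sqr_ge0 b; lra.
by have := sqr_ge0 a; lra.
Qed.

Lemma monotone_local_lipschitz (R : realType) (d : nat) (d_gt0 : (0 < d)%N)
    (c : 'rV[R]_d * 'rV[R]_d -> R) (U G : set ('rV[R]_d * 'rV[R]_d))
    (p0 : 'rV[R]_d * 'rV[R]_d) :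
  open U -> U p0 -> C2_on U c -> D2xy c p0 \in unitmx ->
  (forall p q, G p -> G q -> c p + c q <= c (p.1, q.2) + c (q.1, p.2)) ->
  exists (r L S : R) (s : 'rV[R]_d * 'rV[R]_d -> 'rV[R]_d),
  [/\ 0 < r, 0 < L, 0 < S &
    (forall p, ball p0 r p -> `|s p| <= S) /\
    forall p q, G p -> G q -> ball p0 r p -> ball p0 r q ->
      `|p - q| <= L * `|s p - s q|].
Proof.
case: p0 => x0 y0 oU U0 C2c; set M := D2xy c _ => Mu mono.
have [L0 L00 hL0] := mulmx_norm_le (invmx M^T).
have [K K0 hK] := mulmx_norm_le (M^T).
(* Since [|w| <= L0 * |v|], this tolerance gives exactly the factor [4^-1] of [norm_le_sub]. *)
have e0 : 0 < (4 * L0)^-1 by rewrite invr_gt0 mulr_gt0.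
have [r r0 hr] := C2_mixed_difference oU U0 C2c e0.
pose s (p : 'rV[R]_d * 'rV[R]_d) := p.1 - p.2 *m M^T.
(* The parts of [p - q] in [x] and [y] cost factors [2d] and [L0 * 2d]; their sum dominates the
   maximum that defines the product norm. The third witness bounds [|x| + K * |y|] on the ball. *)
exists r, ((1 + L0) * (d%:R * 2)), (`|x0| + r + K * (`|y0| + r)), s; split=> //.
- by rewrite !mulr_gt0 ?ltr0n// addr_gt0.
- by apply: addr_gt0; [rewrite ltr_wpDl|rewrite mulr_gt0// ltr_wpDl].
split.
  have aux (a b : 'rV[R]_d) : `|a - b| < r -> `|b| <= `|a| + r.
    by have := ler_normB a (a - b); rewrite subKr; lra.
  move=> [x y] [] /=; rewrite -!ball_normE /= => x1 y1.
  rewrite /s /= (le_trans (ler_normB _ _))// lerD//; first exact: aux.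
  by rewrite (le_trans (hK _))// ler_wpM2l//; [exact: ltW|exact: aux].
move=> [x y] [x' y'] Gp Gq [/= x1 y1] [/= x'1 y'1].
move: x1 y1 x'1 y'1; rewrite -!ball_normE /= => x1 y1 x'1 y'1.
pose u := x - x'; pose w := y - y'; pose v := w *m M^T.
have suv : s (x, y) - s (x', y') = u - v.
  by rewrite /s /u /v /w /= mulmxBl; apply/rowP => i; rewrite !mxE; ring.
(* Nondegeneracy enters here: [w] is recovered from [v] by the inverse of [M^T]. *)
have wv : `|w| <= L0 * `|v|.
  by rewrite (le_trans _ (hL0 v))// /v mulmxK// unitmx_tr.
have uv : \sum_(i < d) u 0 i * v 0 i <= 4^-1 * (`|u| * `|v|).
  have := hr x x' y y' x1 x'1 y1 y'1; rewrite -/u -/w -/M ler_norml =>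
    /andP[+ _].
  have -> : \sum_(i < d) \sum_(j < d) u 0 i * w 0 j * M i j = \sum_(i < d) u 0
    i * v 0 i.
    apply: eq_bigr => i _; rewrite [v 0 i]mxE mulr_sumr; apply: eq_bigr => j _.
    by rewrite [M^T _ _]mxE mulrA.
  have := mono _ _ Gp Gq => /= m1 m2.
  rewrite (@le_trans _ _ ((4 * L0)^-1 * `|u| * `|w|))//; first by lra.
  rewrite (@le_trans _ _ ((4 * L0)^-1 * `|u| * (L0 * `|v|)))//.
    by rewrite ler_wpM2l// mulr_ge0// ltW.
  by rewrite le_eqVlt; apply/orP; left; apply/eqP; field; rewrite gt_eqF.
have [hu hv] := norm_le_sub d_gt0 uv.
rewrite suv prod_normE/= ge_max -/u -/w; apply/andP; split.
  rewrite (le_trans hu)// ler_wpM2r// ler_peMl ?mulr_ge0//.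
  by rewrite lerDl ltW.
rewrite (le_trans wv)// (le_trans (ler_wpM2l (ltW L00) hv))//.
by rewrite [leLHS]mulrA ler_wpM2r// ler_wpM2r ?mulr_ge0// lerDr.
Qed.

(** * Covering numbers *)

(* A quantitative form of: the upper box dimension of [A] is at most [d]. *)
Definition box_covered (R : realType) (V : normedModType R) (d : nat)
    (A : set V) : Prop :=
  exists (M : nat) (D : R), 0 < D /\ forall k : nat,
    exists2 l : seq V, (size l <= M * k.+1 ^ d)%N &
      forall p, A p -> exists2 q, q \in l & `|p - q| <= D / k.+1%:R.

Lemma box_coveredS (R : realType) (V : normedModType R) (d : nat) (A B :
  set V) :
  A `<=` B -> box_covered d B -> box_covered d A.
Proof.
move=> AB [M [D [D0 cov]]]; exists M, D; split=> // k.
by have [l ls lB] := cov k; exists l => // p /AB; exact: lB.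
Qed.

Lemma box_covered0 (R : realType) (V : normedModType R) (d : nat) :
  box_covered d (set0 : set V).
Proof. by exists 0%N, 1; split=> // k; exists [::]. Qed.

Lemma box_coveredU (R : realType) (V : normedModType R) (d : nat) (A B :
  set V) :
  box_covered d A -> box_covered d B -> box_covered d (A `|` B).
Proof.
move=> [M [D [D0 cA]]] [M' [D' [D'0 cB]]].
exists (M + M')%N, (Num.max D D'); split=> [|k]; first by rewrite lt_max D0.
have [l ls lA] := cA k; have [l' ls' lB] := cB k.
exists (l ++ l') => [|p [/lA|/lB] [q ql pq]].
- by rewrite size_cat mulnDl leq_add.
- exists q; first by rewrite mem_cat ql.
  by rewrite (le_trans pq)// ler_pM2r ?invr_gt0// le_max lexx.
- exists q; first by rewrite mem_cat ql orbT.
  by rewrite (le_trans pq)// ler_pM2r ?invr_gt0// le_max lexx orbT.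
Qed.

(** The local constants depend on the point, but a finite subcover suffices and finite unions
    preserve [box_covered]. *)
Lemma compact_box_covered (R : realType) (V : normedModType R) (d : nat)
    (A : set V) : compact A ->
  (forall p, A p -> exists2 r : R, 0 < r & box_covered d (A `&` ball p r)) ->
  box_covered d A.
Proof.
move=> cA loc.
have rP (p : V) : exists r : R, A p -> 0 < r /\ box_covered d (A `&` ball p r).
  have [Ap|nAp] := pselect (A p); last by exists 0.
  by have [r r0 br] := loc p Ap; exists r.
have [r hr] := choice rP.
move: cA; rewrite compact_cover => /(_ V A (fun p => ball p (r p))) [].
- by move=> p Ap; exact: ball_open.
- by move=> p Ap; exists p => //; apply: ballxx; exact: (hr p Ap).1.
move=> D' D'A covA.
have covs x : A x -> exists2 p, p \in finmap.enum_fset D' & ball p (r p) x.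
  by move=> /covA [p pD' px]; exists p.
have sA q : q \in finmap.enum_fset D' -> A q by move=> /D'A /set_mem.
suff : forall s : seq V, (forall q, q \in s -> A q) ->
    box_covered d (A `&` \bigcup_(p in [set` s]) ball p (r p)).
  move/(_ _ sA); apply: box_coveredS => x Ax; split=> //.
  by have [p ps px] := covs x Ax; exists p.
elim=> [|p s IH] sD'.
    apply: (box_coveredS _ (@box_covered0 _ _ _)) => x [_ [q]].
    by rewrite /= in_nil.
  apply: (@box_coveredS _ _ _ _ ((A `&` ball p (r p)) `|`
     (A `&` \bigcup_(p in [set` s]) ball p (r p)))).
    move=> x [Ax [q /=]]; rewrite in_cons => /orP[/eqP -> ?|qs ?];
      first by left.
    by right; split=> //; exists q.
  apply: box_coveredU.
    by apply: (hr p _).2; apply: sD'; rewrite mem_head.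
  by apply: IH => q qs; apply: sD'; rewrite in_cons qs orbT.
Qed.

Lemma truncn_eq_dist (R : realType) (x y : R) : 0 <= x -> 0 <= y ->
  Num.truncn x = Num.truncn y -> `|x - y| <= 1.
Proof.
move=> x0 y0 xy; have := truncn_itv x0; have := truncn_itv y0.
rewrite xy -natr1 => /andP[? ?] /andP[? ?].
by rewrite ler_norml; apply/andP; split; lra.
Qed.

(* The cube [-S, S]^d is cut into [(k+2)^d] cells of side [2S / (k+1)], and one
   point of [A] is kept for each cell of its image. *)
Lemma lipschitz_inv_box_covered (R : realType) (V : normedModType R) (d : nat)
    (A : set V) (s : V -> 'rV[R]_d) (S L : R) : 0 < S -> 0 < L ->
  (forall p, A p -> `|s p| <= S) ->
  (forall p q, A p -> A q -> `|p - q| <= L * `|s p - s q|) ->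
  box_covered d A.
Proof.
(* The factor [2 ^ d] absorbs [(k+2)^d] into [(k+1)^d]; [L * (2 * S)] is the Lipschitz constant
   times the side of the cube. *)
move=> S0 L0 sS sL; exists (2 ^ d)%N, (L * (2 * S)); split.
  by rewrite mulr_gt0// mulr_gt0.
move=> k.
(* Coordinates rescaled to [[0, k+1]]; the right endpoint may be attained, hence [k+2] values of the
   truncation. *)
pose co (p : V) (i : 'I_d) : R := (s p 0 i + S) / (2 * S) * k.+1%:R.
have S20 : 0 < 2 * S by rewrite mulr_gt0.
have co_ge0 p i : A p -> 0 <= co p i.
  move=> /sS sp; apply: mulr_ge0 => //; apply: divr_ge0; last exact: ltW.
  by have := le_trans (rV_coord_norm_le (s p) i) sp; rewrite ler_norml =>
    /andP[]; lra.
have co_le p i : A p -> co p i <= k.+1%:R.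
  move=> /sS sp; rewrite ler_piMl// ler_pdivrMr// mul1r.
  by have := le_trans (rV_coord_norm_le (s p) i) sp; rewrite ler_norml =>
    /andP[]; lra.
pose f (p : V) : {ffun 'I_d -> 'I_k.+2} := [ffun i =>
  inord (Num.truncn (co p i))].
have repP (a : {ffun 'I_d -> 'I_k.+2}) :
    exists q : V, (exists2 p, A p & f p = a) -> A q /\ f q = a.
  have [[p Ap fp]|no] := pselect (exists2 p, A p & f p = a); first by exists p.
  by exists 0.
have [rep hrep] := choice repP.
exists [seq rep a | a <- enum {: {ffun 'I_d -> 'I_k.+2}}].
  rewrite size_map -cardE card_ffun !card_ord -expnMn.
  have [-> //|d0] := posnP d.
  by rewrite leq_exp2r// mul2n -addnn addnS ltnS leq_addr.
move=> p Ap; exists (rep (f p)); first by apply: map_f; rewrite mem_enum.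
have [Aq fq] := hrep (f p) (ex_intro2 _ _ p Ap erefl).
set q := rep (f p) in Aq fq *.
rewrite (le_trans (sL _ _ Ap Aq))// -mulrA ler_pM2l//.
apply: rV_norm_le => [|i]; first by rewrite divr_ge0// ltW.
have tr z : A z -> (Num.truncn (co z i) < k.+2)%N.
  by move=> Az; rewrite truncn_lt_nat ?co_ge0// (le_lt_trans (co_le _ _ Az))//
    ltr_nat.
have /(congr1 (fun g : {ffun 'I_d -> 'I_k.+2} => val (g i))) := fq.
rewrite /f !ffunE /= !inordK ?tr// =>
  /esym/(truncn_eq_dist (co_ge0 p i Ap) (co_ge0 q i Aq)).
rewrite /co -mulrBl -mulrBl -[X in `|X|]mulrA normrM.
have w0 : 0 <= (2 * S)^-1 * k.+1%:R by rewrite mulr_ge0// invr_ge0 ltW.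
rewrite (ger0_norm w0) => h.
have -> : (s p - s q) 0 i = (s p 0 i + S) - (s q 0 i + S) by rewrite !mxE; ring.
by rewrite ler_pdivlMr// -[2 * S]mul1r -ler_pdivrMr// mulrAC -mulrA.
Qed.

(** * Quantization *)

Lemma eucl_norm_sqr_le (R : realType) (d : nat) (p : 'rV[R]_d * 'rV[R]_d) :
  eucl_norm p ^+ 2 <= (2 * d)%:R * `|p| ^+ 2.
Proof.
rewrite /eucl_norm sqr_sqrtr; last first.
  by apply: addr_ge0; apply: sumr_ge0 => i _; exact: sqr_ge0.
rewrite mulnC natrM mulrAC mulr_natr [_ *+ 2]mulr2n.
have le1 (x : 'rV[R]_d) : `|x| <= `|p| ->
    \sum_(i < d) x 0 i ^+ 2 <= d%:R * `|p| ^+ 2.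
  move=> xp; rewrite (le_trans (sum_sqr_le_norm x))// ler_wpM2l//.
  by rewrite lerXn2r ?nnegrE.
by apply: lerD; apply: le1; rewrite prod_normE/= le_max lexx ?orbT.
Qed.

Lemma measurable_rV_coord (R : realType) (d : nat) (i : 'I_d) :
  measurable_fun (setT : set (borelRV R d)) (fun x : borelRV R d => (x :
    'rV[R]_d) 0 i).
Proof.
move=> mT; apply: (measurability _ (RGenOInfty.measurableE R)) => //.
move=> _ [_ [a ->] <-]; rewrite setTI; apply: open_measurable_rV.
by apply: open_comp => // x _; exact: coord_continuous.
Qed.

(** Stated for two maps so as to serve both the norm ([g] constant) and the distance ([f], [g] the
    projections). The square removes the root and leaves a polynomial in the coordinates. *)
Lemma measurable_eucl_norm_sqr (R : realType) (d : nat) dd (T :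
  measurableType dd)
    (f g : T -> borelRV R d * borelRV R d) :
  measurable_fun setT f -> measurable_fun setT g ->
  measurable_fun setT (fun z => (eucl_norm ((f z :
    'rV[R]_d * 'rV[R]_d) - g z) ^+ 2)).
Proof.
move=> mf mg.
rewrite (_ : (fun z => _) = (fun z =>
    \sum_(i < d) ((f z).1 0 i - (g z).1 0 i) ^+ 2 +
    \sum_(i < d) ((f z).2 0 i - (g z).2 0 i) ^+ 2)); last first.
  apply/funext => z; rewrite /eucl_norm sqr_sqrtr; last first.
    by apply: addr_ge0; apply: sumr_ge0 => i _; exact: sqr_ge0.
  by congr (_ + _); apply: eq_bigr => i _; rewrite !mxE.
have mc (h : T -> borelRV R d) i : measurable_fun setT h ->
    measurable_fun setT (fun z => (h z : 'rV[R]_d) 0 i).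
  by move=> mh; apply: (measurableT_comp (@measurable_rV_coord R d i)).
have m1 (h : T -> borelRV R d * borelRV R d) : measurable_fun setT h ->
    measurable_fun setT (fun z => (h z).1).
  by move=> mh; exact: (measurableT_comp measurable_fst).
have m2 (h : T -> borelRV R d * borelRV R d) : measurable_fun setT h ->
    measurable_fun setT (fun z => (h z).2).
  by move=> mh; exact: (measurableT_comp measurable_snd).
by apply: measurable_funD; apply: measurable_sum => i; apply: measurable_funX;
  apply: measurable_funB; apply: mc; do ?[exact: m1|exact: m2].
Qed.

Section first_close.
Context (R : realType) (V : normedModType R) (r : R).

(** Taking the first point within [r], rather than a nearest one, reduces measurability to finitely
    many closed conditions. The default [0] is not reached on a set covered by the balls. *)
Fixpoint first_close (l : seq V) (z : V) : V :=
  if l is q :: l' then (if `|z - q| <= r then q else first_close l' z) else 0.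

Lemma first_closeP (l : seq V) (z : V) :
  (exists2 q, q \in l & `|z - q| <= r) ->
  first_close l z \in l /\ `|z - first_close l z| <= r.
Proof.
elim: l => [[q]//|p l IH] [q]; rewrite inE /=; case: ifPn => [zp _ _|zp].
  by rewrite mem_head.
move=> /orP[/eqP ->|ql zq]; first by move=> zp'; rewrite zp' in zp.
by have [] := IH (ex_intro2 _ _ q ql zq); rewrite inE => -> ->; rewrite orbT.
Qed.

End first_close.

Lemma measurable_first_close (R : realType) (d : nat) (r : R)
    (l : seq ('rV[R]_d * 'rV[R]_d)) :
  measurable_fun (setT : set (borelRV R d * borelRV R d))
    (first_close r l : _ -> borelRV R d * borelRV R d).
Proof.
elim: l => [|q l IH] /=; first exact: measurable_cst.
apply: measurable_fun_ifT => //.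
apply: (measurable_fun_bool true); rewrite setTI.
apply: closed_measurable_rV2.
rewrite (_ : _ @^-1` _ = (fun z => `|z - q|) @^-1` [set x | x <= r])//.
apply: closed_comp => [z _|]; last exact: closed_le.
by apply: cvg_norm; apply: cvgB => //; exact: cvg_cst.
Qed.

(** The image of [pi] under [z |-> (T z, z)] couples the quantized measure with [pi] and moves each
    point of [G] by at most [r]. *)
Lemma W2_quantize (R : realType) (d : nat)
    (pi : probability (borelRV R d * borelRV R d)%type R)
    (G : set ('rV[R]_d * 'rV[R]_d)) (l : seq ('rV[R]_d * 'rV[R]_d)) (r : R) (n :
      nat) :
  (0 < d)%N ->
  measurable (G : set (borelRV R d * borelRV R d)) -> pi G = 1%E ->
  0 <= r -> (forall p, G p -> exists2 q, q \in l & `|p - q| <= r) ->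
  (size l <= n)%N ->
  exists pin : probability (borelRV R d * borelRV R d)%type R,
    (exists2 S : set (borelRV R d * borelRV R d),
      (S #<= `I_n)%card & pin S = 1%E) /\
    (W2 pin pi <= ((2 * d)%:R * r)%:E)%E.
Proof.
move=> d0 mG piG r0 Gl ln.
pose T : borelRV R d * borelRV R d -> borelRV R d * borelRV R d :=
  first_close r l.
have mT : measurable_fun setT T by exact: measurable_first_close.
have [pin pinE] := probability_pushforward pi mT.
have mTid : measurable_fun setT (fun z => (T z, z)).
  by apply: measurable_fun_pair => //; exact: measurable_id.
have [g gE] := probability_pushforward pi mTid.
have piG1 (A : set (borelRV R d * borelRV R d)) : measurable A -> G `<=` A ->
  pi A = 1%E.
  move=> mA GA; apply/eqP; rewrite eq_le probability_le1//= -piG.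
  by rewrite le_measure ?inE.
have ml : measurable ([set` l] : set (borelRV R d * borelRV R d)).
  apply: closed_measurable_rV2; apply: compact_closed; first exact:
    norm_hausdorff.
  by apply: finite_compact; exact: finite_seq.
exists pin; split.
  exists [set` l].
    apply: (@card_le_trans _ _ _ (nth 0 l @` `I_(size l))).
      apply: subset_card_le => p /= pl; exists (index p l); last exact:
        nth_index.
      by rewrite /= index_mem.
    by rewrite (card_le_trans (card_image_le _ _))// card_le_II.
  rewrite pinE /pushforward; apply: piG1.
    by have := mT measurableT _ ml; rewrite setTI.
  by move=> p /Gl /first_closeP[].
have cg : coupling pin pi g.
  by split=> A mA; rewrite ?pinE gE.
pose u := (2 * d)%:R * r ^+ 2.
have u0 : 0 <= u by rewrite mulr_ge0// sqr_ge0.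
have md : measurable_fun setT (fun z :
  (borelRV R d * borelRV R d) * (borelRV R d * borelRV R d) =>
    eucl_dist z.1 z.2 ^+ 2).
  exact: measurable_eucl_norm_sqr.
have md_le : measurable [set z :
  (borelRV R d * borelRV R d) * (borelRV R d * borelRV R d) |
    eucl_dist z.1 z.2 ^+ 2 <= u].
  have := md measurableT _ (measurable_itv `]-oo, u]); rewrite setTI.
  by congr (measurable _); apply/seteqP; split=> z /=; rewrite in_itv.
have intg : (\int[g]_z (eucl_dist z.1 z.2 ^+ 2)%:E <= u%:E)%E.
  apply: (@integral_le_cst _ _ _ g [set z | eucl_dist z.1 z.2 ^+ 2 <= u]) => //.
  - rewrite gE /pushforward; apply: piG1.
      by have := mTid measurableT _ md_le; rewrite setTI.
    move=> p /Gl /first_closeP[_ Tp] /=.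
    rewrite (le_trans (eucl_norm_sqr_le _))// ler_wpM2l//.
    by rewrite lerXn2r ?nnegrE// distrC.
  - exact/measurable_EFinP.
  - by move=> z; rewrite lee_fin sqr_ge0.
(* Monotonicity of the power requires the infimum to be nonnegative. Afterwards [2d <= (2d)^2]
   replaces the root of [2d] by [2d]. *)
rewrite /W2 (@le_trans _ _ (u%:E `^ 2^-1)%E)//.
  apply: gt0_ler_poweR => //.
  - rewrite in_itv/= leey andbT; apply: le_ereal_inf_tmp => _ [h _ <-].
    by apply: integral_ge0 => z _; rewrite lee_fin sqr_ge0.
  - by rewrite in_itv/= leey andbT lee_fin.
  - by apply: ge_ereal_inf; exists (\int[g]_z (eucl_dist z.1 z.2 ^+ 2)%:E)%E =>
    //; exists g.
rewrite poweR_EFin lee_fin.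
rewrite powR12_sqrt// -[leRHS]ger0_norm ?mulr_ge0// -sqrtr_sqr ler_wsqrtr//.
rewrite exprMn ler_wpM2r ?sqr_ge0// -natrX ler_nat.
by rewrite -{1}[(2 * d)%N]muln1 expnS expn1 leq_mul2l muln_gt0 d0 orbT.
Qed.

Lemma box_covered_quant2 (R : realType) (d : nat)
    (pi : probability (borelRV R d * borelRV R d)%type R)
    (G : set ('rV[R]_d * 'rV[R]_d)) :
  (0 < d)%N ->
  measurable (G : set (borelRV R d * borelRV R d)) -> pi G = 1%E ->
  box_covered d G -> exists2 C : R, 0 < C & quant2 C d%:R^-1 pi.
Proof.
move=> d0 mG piG [M0 [D [D0 cov]]].
(* Positivity of [M] bounds the indices [k] with [M * k.+1 ^ d <= n], so that a largest one
   exists. *)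
pose M := M0.+1.
have [l0 _ hl0] := cov 0%N.
(* The covering at scale [k = 0] already shows that [G] is bounded. *)
pose B := D + \sum_(q <- l0) `|q|.
have B0 : 0 < B by rewrite ltr_wpDr// sumr_ge0.
have GB p : G p -> `|p| <= B.
  move=> /hl0[q ql]; rewrite divr1 => pq.
  rewrite -[p](subrK q) (le_trans (ler_normD _ _))// lerD//.
  by rewrite (big_rem q)//= lerDl sumr_ge0.
have d'0 : 0 < (2 * d)%:R :> R by rewrite ltr0n muln_gt0.
have dR0 : (d%:R : R) != 0 by rewrite pnatr_eq0 -lt0n.
have root (n m : nat) : (n <= m ^ d)%N -> (n%:R : R) `^ d%:R^-1 <= m%:R.
  move=> nm; rewrite -[leRHS](@powRr1 R)//
    -[X in _ <= _ `^ X](mulfV dR0) powRrM.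
  by rewrite ge0_ler_powR ?nnegrE ?invr_ge0// powR_mulrn// -natrX ler_nat.
(* [2d] comes from [W2_quantize], [M * 2D] from the case [M <= n], and [M * B] from the case
   [n < M]. *)
pose C := (2 * d)%:R * (M%:R * (2 * D + B)).
have C0 : 0 < C by rewrite !mulr_gt0// addr_gt0// mulr_gt0.
exists C => //; split.
  rewrite /finite_second_moment.
  apply: (@le_lt_trans _ _ ((2 * d)%:R * B ^+ 2)%:E); last exact: ltry.
  apply: (integral_le_cst mG piG).
  - apply/measurable_EFinP.
    have := @measurable_eucl_norm_sqr R d _ _ id (cst (0 : 'rV[R]_d, 0 :
      'rV[R]_d))
      (@measurable_id _ _ setT) (measurable_cst _).
    by congr measurable_fun; apply/funext => z; congr (eucl_norm _ ^+ 2);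
      rewrite subr0.
  - by move=> z; rewrite lee_fin sqr_ge0.
  - move=> z Gz; rewrite lee_fin (le_trans (eucl_norm_sqr_le _))// ler_wpM2l//.
    by rewrite lerXn2r ?nnegrE ?GB// ltW.
move=> n n1.
have nR : 0 < n%:R :> R by rewrite ltr0n.
set t : R := n%:R `^ (- d%:R^-1).
have tE : t = (n%:R `^ d%:R^-1)^-1 by rewrite /t powRN.
have t0 : 0 < t by rewrite powR_gt0.
suff [l [r [r0 ln rt hl]]] : exists (l : seq ('rV[R]_d * 'rV[R]_d)) (r : R),
    [/\ 0 <= r, (size l <= n)%N, r <= M%:R * (2 * D + B) * t &
      forall p, G p -> exists2 q, q \in l & `|p - q| <= r].
  have [pin [pinS pinW]] := W2_quantize d0 mG piG r0 hl ln.
  exists pin; split=> //; rewrite (le_trans pinW)// lee_fin /C -mulrA.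
  by rewrite ler_wpM2l// ltW.
(* For [n < M] the covering lists may be too long even at [k = 0]; the origin alone has error at
   most [B], and [n^(1/d) <= M]. *)
have [nM|Mn] := ltnP n M.
  exists [:: 0], B; split=> //; first exact: ltW.
    rewrite tE ler_pdivlMr ?powR_gt0//.
    have nM' : n%:R `^ d%:R^-1 <= M%:R :> R.
      by apply: root; rewrite (leq_trans (ltnW nM))// -{1}(expn1 M) leq_pexp2l.
    rewrite (@le_trans _ _ (B * M%:R))//; first by rewrite ler_wpM2l// ltW.
    by rewrite mulrC ler_wpM2l// lerDr mulr_ge0// ltW.
  by move=> p Gp; exists 0; rewrite ?mem_head// subr0 GB.
have exk : exists k, (M * k.+1 ^ d <= n)%N by exists 0%N; rewrite exp1n muln1.
have ubk k : (M * k.+1 ^ d <= n)%N -> (k <= n)%N.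
  move=> /(leq_trans _); apply; rewrite (@leq_trans (k.+1 ^ d))//;
    last by rewrite leq_pmull.
  by rewrite (leq_trans (leqnSn _))// -{1}(expn1 k.+1) leq_pexp2l.
case: (ex_maxnP exk ubk) => k kn kmax.
(* Maximality of [k] gives [n < M * k.+2 ^ d], so [n^(1/d) <= M * k.+2 <= 2 * M * k.+1]: the radius
   [D / k.+1] has the desired order. *)
have nk : (n <= (M * k.+2) ^ d)%N.
  have : ~~ (M * k.+2 ^ d <= n)%N by apply/negP => /kmax; rewrite ltnn.
  rewrite -ltnNge => /ltnW /leq_trans; apply; rewrite expnMn leq_mul2r.
  by rewrite -{1}(expn1 M) leq_pexp2l ?orbT.
have [l ls hl] := cov k.
exists l, (D / k.+1%:R); split=> //; first by rewrite divr_ge0// ltW.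
  by rewrite (leq_trans ls)// (leq_trans _ kn)// leq_mul2r leqnSn orbT.
rewrite tE ler_pdivlMr ?powR_gt0// mulrAC ler_pdivrMr//.
have := root _ _ nk; rewrite natrM => hn.
rewrite (@le_trans _ _ (D * (M%:R * k.+2%:R)))//; first by rewrite ler_wpM2l//
  ltW.
have k2 : k.+2%:R <= 2 * k.+1%:R :> R.
  by rewrite -natrM ler_nat mul2n -addnn addnS ltnS leq_addr.
rewrite (@le_trans _ _ (D * (M%:R * (2 * k.+1%:R))))//.
  by apply: ler_wpM2l; [exact: ltW|rewrite ler_wpM2l].
rewrite (_ : D * _ = M%:R * (2 * D) * k.+1%:R); last by ring.
by rewrite ler_wpM2r// ler_wpM2l// lerDl ltW.
Qed.

Theorem lemma3p15 (R : realType) (d : nat) (d_gt0 : (0 < d)%N)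
    (X1 X2 : set 'rV[R]_d)
    (X1_closed : closed X1) (X2_closed : closed X2)
    (X1_convex : convex_set (X1 : set (convex_lmodType 'rV[R]_d)))
    (X2_convex : convex_set (X2 : set (convex_lmodType 'rV[R]_d)))
    (c : 'rV[R]_d * 'rV[R]_d -> R)
    (c_C2 : C2_near (X1 `*` X2) c)
    (c_nondeg : nondegenerate_cost (X1 `*` X2) c)
    (mu1 mu2 : probability (borelRV R d) R)
    (mu1_X1 : mu1 X1 = 1%E) (mu2_X2 : mu2 X2 = 1%E)
    (mu1_compact : compact (msupport (mu1 : set 'rV[R]_d -> \bar R)))
    (mu2_compact : compact (msupport (mu2 : set 'rV[R]_d -> \bar R)))
    (pi : probability (borelRV R d * borelRV R d)%type R)
    (pi_opt : optimal_transport X1 X2 c mu1 mu2 pi) :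
  exists2 C : R, 0 < C & quant2 C d%:R^-1 pi.
Proof.
have [U [oU XU] C2c] := c_C2.
have c_cont z : (X1 `*` X2) z -> {for z, continuous c}.
  by move=> /XU /C2c.1[/differentiable_continuous].
pose G := msupport (pi : set ('rV[R]_d * 'rV[R]_d) -> \bar R).
have mono : forall p q, G p -> G q -> c p + c q <= c (p.1, q.2) + c (q.1, p.2).
  exact: (optimal_transport_monotone X1_closed X2_closed mu1_X1 mu2_X2
    mu1_compact mu2_compact c_cont pi_opt).
have GK := coupling_msupport X1_closed X2_closed mu1_X1 mu2_X2 pi_opt.1.
have cG : closed G by exact: msupport_closed.
have compG : compact G.
  apply: (subclosed_compact cG _ GK); apply: compact_setX; rewrite setIC;
    exact: compact_closedI.
have mG : measurable (G : set (borelRV R d * borelRV R d)).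
  exact: closed_measurable_rV2.
apply: (box_covered_quant2 d_gt0 mG).
  by apply: probability_setC0 => //; exact: msupport_rV2.
apply: compact_box_covered compG _ => p Gp.
have Xp : (X1 `*` X2) p by have [[? _] [? _]] := GK _ Gp.
have [r [L [S [s [r0 L0 S0 [sS sL]]]]]] :=
  monotone_local_lipschitz d_gt0 oU (XU _ Xp) C2c (c_nondeg _ Xp) mono.
exists r => //; apply: (lipschitz_inv_box_covered S0 L0 (s := s)).
  by move=> q [_ /sS].
by move=> q q' [Gq qr] [Gq' q'r]; exact: sL.
Qed.
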